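(* Let $\Lambda\neq\{1\}$ be a discrete group and let $\Gamma$ be a non-amenable discrete group. Then $\Lambda_{\mathrm{cb}}(\Lambda\wr\Gamma)>1$, i.e. $L(\Lambda\wr\Gamma)$ does not have the complete metric approximation property.
   Context: The wreath product $\Lambda\wr\Gamma$ is the semi-direct product $(\bigoplus_\Gamma\Lambda)\rtimes\Gamma$ of $\bigoplus_\Gamma\Lambda$ by the shift action of $\Gamma$. For a discrete group $G$ and a function $f$ on $G$, $\|f\|_{\mathrm{cb}}$ denotes the completely bounded norm of the multiplier $m_f$ on $\mathbb CG\subset L(G)$, $m_f(g)=fg$ (pointwise product). The Cowling–Haagerup constant $\Lambda_{\mathrm{cb}}(G)$ is the infimum of the constants $C\ge1$ for which there is a net $(f_n)$ of finitely supported functions on $G$ with $\limsup\|f_n\|_{\mathrm{cb}}\le C$ and $f_n\to1$ pointwise ($\Lambda_{\mathrm{cb}}(G)=\infty$ if no such $C$ exists). A finite von Neumann algebra $(M,\tau)$ has the complete metric approximation property if $\Lambda_{\mathrm{cb}}(M)=1$, where $\Lambda_{\mathrm{cb}}(M)$ is the infimum of the constants $C\ge1$ for which there is a net $(\phi_n)$ of normal finite-rank maps on $M$ with $\limsup\|\phi_n\|_{\mathrm{cb}}\le C$ and $\|x-\phi_n(x)\|_2\to0$ for all $x\in M$. (The letter $\Lambda$ for the group and the symbol $\Lambda_{\mathrm{cb}}$ are unrelated.) *)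

(* Defs.v *)
From HB Require Import structures.
From mathcomp Require Import all_boot all_order all_algebra.
From mathcomp Require Import finmap complex ring lra.
From mathcomp Require Import all_classical all_reals all_analysis.
From mathcomp.analysis.showcase Require summability.

Set Implicit Arguments.
Unset Strict Implicit.
Unset Printing Implicit Defensive.

Import Order.TTheory GRing.Theory Num.Theory.
Import numFieldNormedType.Exports.
Import ComplexField ComplexField.Normc.

Local Open Scope classical_set_scope.
Local Open Scope ring_scope.

Section Amenability.
Variables (R : realType) (G : groupType).

Definition bounded_fct (u : G -> R) : Prop :=
  exists k : R, forall g, `|u g| <= k.

(* [m] only matters on bounded functions: it is an invariant mean on
   l^oo(G). *)
Definition left_invariant_mean (m : (G -> R) -> R) : Prop :=
  [/\ forall (a : R) (u v : G -> R), bounded_fct u -> bounded_fct v ->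
        m (a *: u + v) = a * m u + m v,
      forall u : G -> R, bounded_fct u -> (forall g, 0 <= u g) -> 0 <= m u,
      m (fun=> 1) = 1
    & forall (s : G) (u : G -> R), bounded_fct u ->
        m (fun g => u (s^-1 * g)%g) = m u].

Definition amenable : Prop := exists m, left_invariant_mean m.

End Amenability.

Section WreathProduct.
Variables L G : groupType.

(* Elements (f, s) of (⊕_G L) ⋊ G, with f : G -> L finitely supported;
   s in G acts on f by (s . f) x = f (s^-1 x). *)
Record wreath : Type := Wreath {
  lamps : G -> L;
  lamps_fin : finite_set [set x | lamps x != 1%g];
  cursor : G }.

HB.instance Definition _ := gen_eqMixin wreath.
HB.instance Definition _ := gen_choiceMixin wreath.

Lemma wreath_eq (u v : wreath) :
  (forall x, lamps u x = lamps v x) -> cursor u = cursor v -> u = v.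
Proof.
case: u v => [f pf s] [g pg t] /= fg st.
have efg : f = g by exact/funext.
by subst g t; rewrite (Prop_irrelevance pf pg).
Qed.

Lemma shift_fin (f : G -> L) (s : G) :
  finite_set [set x | f x != 1%g] -> finite_set [set x | f (s * x)%g != 1%g].
Proof.
move=> ff; apply: (@sub_finite_set _ _ ((fun x => (s^-1 * x)%g) @`
  [set x | f x != 1%g])); last exact: finite_image.
by move=> x /= fx; exists (s * x)%g => //; rewrite mulKg.
Qed.

Lemma wreath_one_fin : finite_set [set x : G | (1 : L)%g != 1%g].
Proof.
by rewrite (_ : mkset _ = set0)//; apply/seteqP; split=> x //=; rewrite eqxx.
Qed.

Definition wreath_one : wreath := Wreath wreath_one_fin 1%g.

Lemma wreath_mul_fin (u v : wreath) :
  finite_set [set x | (lamps u x * lamps v ((cursor u)^-1 * x))%g != 1%g].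
Proof.
apply: (@sub_finite_set _ _ ([set x | lamps u x != 1%g] `|`
   [set x | lamps v ((cursor u)^-1 * x)%g != 1%g])); last first.
  by rewrite finite_setU; split; [exact: lamps_fin|apply/shift_fin/lamps_fin].
move=> x /=; have [->|ux] := eqVneq (lamps u x) 1%g; last by left.
by rewrite mul1g; right.
Qed.

Definition wreath_mul (u v : wreath) : wreath :=
  Wreath (wreath_mul_fin u v) (cursor u * cursor v)%g.

Lemma wreath_inv_fin (u : wreath) :
  finite_set [set x | ((lamps u (cursor u * x))^-1)%g != 1%g].
Proof.
apply: (@sub_finite_set _ _ [set x | lamps u (cursor u * x)%g != 1%g]).
  by move=> x /=; apply: contra_neq => ->; rewrite invg1.
exact/shift_fin/lamps_fin.
Qed.

Definition wreath_inv (u : wreath) : wreath :=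
  Wreath (wreath_inv_fin u) (cursor u)^-1%g.

Lemma wreath_mulA : associative wreath_mul.
Proof.
by move=> u v w; apply: wreath_eq => [x|] /=; rewrite ?invgM !mulgA.
Qed.

Lemma wreath_mul1 : left_id wreath_one wreath_mul.
Proof.
by move=> u; apply: wreath_eq => [x|] /=; rewrite ?invg1 !mul1g.
Qed.

Lemma wreath_mulr1 : right_id wreath_one wreath_mul.
Proof. by move=> u; apply: wreath_eq => [x|] /=; rewrite !mulg1. Qed.

Lemma wreath_mulV : left_inverse wreath_one wreath_inv wreath_mul.
Proof.
by move=> u; apply: wreath_eq => [x|] /=; rewrite ?invgK ?mulVg.
Qed.

Lemma wreath_mulrV : right_inverse wreath_one wreath_inv wreath_mul.
Proof.
by move=> u; apply: wreath_eq => [x|] /=; rewrite ?mulVKg ?mulgV.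
Qed.

HB.instance Definition _ := isGroup.Build wreath
  wreath_mulA wreath_mul1 wreath_mulr1 wreath_mulV wreath_mulrV.

End WreathProduct.

Section Ell2.
Variables (R : realType) (I : choiceType).
Local Notation C := R[i].

Definition sqsum (u : I -> C) : \bar R :=
  (\esum_(i in [set: I]) ((normc (u i)) ^+ 2)%:E)%E.

Definition sq_summable : {pred (I -> C)} := fun u => `[< (sqsum u < +oo)%E >].

Lemma sq_summable0 : 0 \in sq_summable.
Proof.
have s0 : sqsum (0 : I -> C) = 0%E.
  by apply: esum1 => i _; rewrite normc0 expr0n.
by apply/asboolP; rewrite s0 ltry.
Qed.

Lemma sqsumZ_le (a : C) (u : I -> C) :
  (sqsum (a *: u) <= ((normc a) ^+ 2)%:E * sqsum u)%E.
Proof.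
apply: ge_ereal_sup => _ [A [finA _] <-].
have -> : (\sum_(x \in A) (normc ((a *: u) x) ^+ 2)%:E
    = ((normc a) ^+ 2)%:E * \sum_(x \in A) (normc (u x) ^+ 2)%:E)%E.
  rewrite ge0_mule_fsumr; last by move=> i; rewrite lee_fin sqr_ge0.
  by apply: eq_fsbigr => i _; rewrite -EFinM -exprMn -normcM.
apply: lee_wpmul2l; first by rewrite lee_fin sqr_ge0.
by apply: ereal_sup_ubound; exists A.
Qed.

Lemma sq_summable_lin : linear_closed sq_summable.
Proof.
move=> a u v /asboolP uoo /asboolP voo; apply/asboolP.
have sq0 (w : I -> C) i : (0 <= ((normc (w i)) ^+ 2)%:E)%E.
  by rewrite lee_fin sqr_ge0.
have Zoo (b : C) w : (sqsum w < +oo -> sqsum (b *: w) < +oo)%E.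
  move=> woo; apply: le_lt_trans (sqsumZ_le b w) _.
  by apply: lte_mul_pinfty => //; rewrite lee_fin sqr_ge0.
pose s := a *: u; have soo : (sqsum s < +oo)%E by exact: Zoo.
have le2 : (sqsum (s + v)%R <= (sqsum s + sqsum s) + (sqsum v + sqsum v))%E.
  rewrite /sqsum -!esumD//; last 2 first.
  - by move=> i _; apply: adde_ge0.
  - by move=> i _; apply: adde_ge0.
  apply: le_esum => i _; rewrite -!EFinD lee_fin.
  have x0 (z : C) : 0 <= normc z by case: z => ? ?; exact: sqrtr_ge0.
  apply: (@le_trans _ _ ((normc (s i) + normc (v i)) ^+ 2)).
    by rewrite ler_pXn2r ?nnegrE ?addr_ge0// le_normcD.
  rewrite -subr_ge0 (_ : _ - _ = (normc (s i) - normc (v i)) ^+ 2) ?sqr_ge0//.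
  by ring.
by apply: le_lt_trans le2 _; rewrite !lte_add_pinfty.
Qed.

HB.instance Definition _ :=
  GRing.isSubmodClosed.Build C (I -> C) sq_summable
    (GRing.submod_closed_semi (conj sq_summable0 sq_summable_lin)).

Record ell2 : Type := Ell2 {
  ell2_fun :> I -> C;
  ell2_subproof : ell2_fun \in sq_summable }.

HB.instance Definition _ := [isSub for ell2_fun].
HB.instance Definition _ := [Choice of ell2 by <:].
HB.instance Definition _ := [SubChoice_isSubLmodule of ell2 by <:].


Definition normsq (x : ell2) : R := fine (sqsum x).

(* <x, y> is linear in x; the sum over I is the limit along the net of finite
   subsets of I. *)
Definition inner (x y : ell2) : C :=
  lim ((fun A : {fset I} => (\sum_(i <- A) x i * (y i)^*%C : C^o))
       @ @summability.totally I).

End Ell2.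

Section Operators.
Variables (R : realType) (I : choiceType).
Local Notation C := R[i].
Local Notation H := (ell2 R I).

Definition bounded_op (T : H -> H) : Prop :=
  linear T /\ exists k : R, forall x, normsq (T x) <= k * normsq x.

(* 0 if T has no adjoint *)
Definition adjoint_op (T : H -> H) : H -> H :=
  xget (fun=> 0) [set S | forall x y, inner (T x) y = inner x (S y)].

Definition tuple_normsq n (v : 'I_n -> H) : R := \sum_i normsq (v i).

Definition mx_opnorm n (T : 'M[H -> H]_n) : \bar R :=
  ereal_sup [set (Num.sqrt (tuple_normsq (fun i => \sum_j T i j (v j))))%:E
            | v in [set v : 'I_n -> H | tuple_normsq v <= 1]].

(* [D] is a subspace of [E], identified with a subspace of B(l^2(I)) through
   [rep]: this is the completely bounded norm of the linear map [phi : D -> D],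
   i.e. the supremum over n of the norms of its amplifications to M_n(D). *)
Definition cb_norm (E : Type) (rep : E -> H -> H) (D : set E) (phi : E -> E) :
    \bar R :=
  ereal_sup [set mx_opnorm (map_mx (rep \o phi) (projT2 x))
            | x in [set x : {n : nat & 'M[E]_n}
                   | (forall i j, D (projT2 x i j)) /\
                     (mx_opnorm (map_mx rep (projT2 x)) <= 1)%E]].

End Operators.

Definition directed (N : Type) (le : N -> N -> Prop) : Prop :=
  [/\ exists n : N, True,
      forall n, le n n,
      forall n p q, le n p -> le p q -> le n q
    & forall n p, exists q, le n q /\ le p q].

Definition tails (N : Type) (le : N -> N -> Prop) : set_system N :=
  filter_from [set: N] (fun n => [set p | le n p]).

Definition net_limsup (R : realType) (N : Type) (le : N -> N -> Prop)
    (u : N -> \bar R) : \bar R :=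
  ereal_inf [set ereal_sup [set u p | p in [set p | le n p]]
            | n in [set: N]].

Section VonNeumann.
Variables (R : realType) (I : choiceType).
Local Notation C := R[i].
Local Notation H := (ell2 R I).
(* Intended for a von Neumann algebra [M] with faithful normal tracial state
   [tau]. Taking M inside B(l^2(I)) is no restriction: every Hilbert space is
   isometric to some l^2(I). *)
Variables (M : set (H -> H)) (tau : (H -> H) -> C).

Definition linear_on (phi : (H -> H) -> H -> H) : Prop :=
  (forall x, M x -> M (phi x)) /\
  (forall (a : C) x y, M x -> M y -> phi (a *: x + y) = a *: phi x + phi y).

(* membership in the predual: omega = sum_k < . xi_k, eta_k > on M, with
   (xi_k) and (eta_k) square summable *)
Definition normal_functional (omega : (H -> H) -> C) : Prop :=
  exists xi eta : nat -> H,
    [/\ (\sum_(0 <= k <oo) (normsq (xi k))%:E < +oo)%E,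
        (\sum_(0 <= k <oo) (normsq (eta k))%:E < +oo)%E
      & forall x, M x ->
          series (fun k => (inner (x (xi k)) (eta k) : C^o)) @ \oo -->
            (omega x : C^o)].

Definition normal_map (phi : (H -> H) -> H -> H) : Prop :=
  forall omega, normal_functional omega -> normal_functional (omega \o phi).

Definition finite_rank (phi : (H -> H) -> H -> H) : Prop :=
  exists (d : nat) (y : 'I_d -> H -> H), forall x, M x ->
    exists c : 'I_d -> C, phi x = \sum_i c i *: y i.

Definition trace_norm2 (x : H -> H) : R :=
  Num.sqrt (complex.Re (tau (adjoint_op x \o x))).

(* [phi n] only matters on [M]. *)
Definition vN_approx_net (c : R) : Prop :=
  exists (N : Type) (le : N -> N -> Prop) (phi : N -> (H -> H) -> H -> H),
    [/\ directed le,
        forall n, [/\ linear_on (phi n), normal_map (phi n)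
                    & finite_rank (phi n)],
        (net_limsup le (fun n => cb_norm id M (phi n)) <= c%:E)%E
      & forall x, M x ->
          (fun n : N => trace_norm2 (x - phi n x)) @ tails le --> (0 : R)].

Definition vN_Lambda_cb : \bar R :=
  ereal_inf [set c%:E | c in [set c : R | 1 <= c /\ vN_approx_net c]].

Definition complete_metric_approximation_property : Prop :=
  vN_Lambda_cb = 1%E.

End VonNeumann.

Section GroupAlgebra.
Variables (R : realType) (G : groupType).
Local Notation C := R[i].
Local Notation H := (ell2 R G).

Lemma ltrans_subproof (g : G) (x : H) :
  (fun h => x (g^-1 * h)%g) \in @sq_summable R G.
Proof.
have := ell2_subproof x; move=> /asboolP xoo; apply/asboolP.
rewrite /sqsum -(@reindex_esum _ _ _ setT setT (fun h => (g^-1 * h)%g)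
  (fun h => ((normc (x h)) ^+ 2)%:E))//.
split=> // [u v _ _|h _]; first exact: mulgI.
by exists (g * h)%g => //; rewrite mulKg.
Qed.

Definition ltrans (g : G) (x : H) : H := Ell2 (ltrans_subproof g x).

Lemma delta1_subproof :
  (fun h : G => (h == 1%g)%:R : C) \in @sq_summable R G.
Proof.
apply/asboolP; rewrite /sqsum (_ : esum _ _ = 1%E) ?ltry//.
rewrite -(@esum_set1 R G 1%g (fun=> 1%E))// [RHS]esum_mkcond.
apply: eq_esum => h _; rewrite in_set1; case: (h == 1%g).
  by rewrite normc1 expr1n.
by rewrite normc0 expr0n.
Qed.

Definition delta1 : H := Ell2 delta1_subproof.

(* an element of CG is a finitely supported function on G *)
Definition finsupp_fun (a : G -> C) : Prop := finite_set [set g | a g != 0].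

(* the image in B(l^2(G)) of the element [a] of CG; only meaningful for finitely
   supported [a] *)
Definition lconv (a : G -> C) (x : H) : H :=
  \sum_(g \in [set: G]) a g *: ltrans g x.

Definition multiplier (f a : G -> C) : G -> C := fun g => f g * a g.

Definition multiplier_cb_norm (f : G -> C) : \bar R :=
  cb_norm lconv finsupp_fun (multiplier f).

Definition group_approx_net (c : R) : Prop :=
  exists (N : Type) (le : N -> N -> Prop) (f : N -> G -> C),
    [/\ directed le,
        forall n, finsupp_fun (f n),
        (net_limsup le (fun n => multiplier_cb_norm (f n)) <= c%:E)%E
      & forall g, (fun n : N => (f n g : C^o)) @ tails le --> (1 : C^o)].

Definition group_Lambda_cb : \bar R :=
  ereal_inf [set c%:E | c in [set c : R | 1 <= c /\ group_approx_net c]].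

(* L(G): the bicommutant of the left regular representation *)
Definition group_vN : set (H -> H) :=
  [set x | bounded_op x /\
     forall y, bounded_op y -> (forall g, y \o ltrans g = ltrans g \o y) ->
       x \o y = y \o x].

Definition group_trace (x : H -> H) : C := inner (x delta1) delta1.

End GroupAlgebra.

Arguments group_vN R G : clear implicits.
Arguments group_trace R G : clear implicits.

(* Main.v *)
(** Write [a] for a nontrivial element of [Lambda] and [N] for the lamp group.
    If either approximation property holds with constant 1, then for every finite
    set of elements and every [e > 0] there is a finitely supported real function
    [g] on the wreath product, [e]-close to 1 on that set, whose kernel
    [g (p q^-1)] is a Schur multiplier of norm at most [1 + e] (in the von Neumann
    case, [g x] is the real part of the [x]-th coordinate of
    [phi (lambda_x) delta_1], truncated).  Since such a multiplier is almost
    extremal at 1, [g t ~ 1] forces [x |-> g (t x) - g x] to have small Schur norm,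
    so [g] is almost invariant under conjugation by [t].

    Consider the elements [n_p] of [N] that equal [a] on a finite set [p] of sites
    and 1 elsewhere.  The diagonal of the matrix [g (n_p n_q^-1)] in the Walsh
    basis is a function [F] on a finite cube with [|F|_1 <= 1 + e], average
    [g 1 ~ 1], and almost invariant in [L^1] under [Gamma].  The Walsh transform of
    [sqrt |F|] is then an almost invariant vector, hence its square is an almost
    invariant measure on finite sets of sites; as [g (n_p) ~ 1] for [p] the
    singleton {1}, it does not concentrate on the empty set.  Averaging functions
    over the sites of a random nonempty set gives almost invariant means on
    [Gamma], so [Gamma] is amenable. *)

Require Import Defs.
From mathcomp Require Import all_boot all_order all_algebra.
From mathcomp Require Import finmap complex ring lra perm.
From mathcomp Require Import all_classical all_reals all_analysis.

Set Implicit Arguments.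
Unset Strict Implicit.
Unset Printing Implicit Defensive.

Import Order.TTheory GRing.Theory Num.Theory.
Import numFieldNormedType.Exports.
Import ComplexField ComplexField.Normc.

Local Open Scope classical_set_scope.
Local Open Scope ring_scope.

(** * Herz-Schur multipliers *)

Section Schur.
Variable R : realType.

Definition sqn (I : finType) (v : I -> R) : R := \sum_i v i ^+ 2.

Definition bilin (I : finType) (A : I -> I -> R) (v w : I -> R) : R :=
  \sum_i \sum_j A i j * v j * w i.

(* AM-GM form of [`|A v . w| <= |v| |w|]. *)
Definition contraction (I : finType) (A : I -> I -> R) : Prop :=
  forall v w, bilin A v w <= (sqn v + sqn w) / 2.

Lemma sqn_ge0 (I : finType) (v : I -> R) : 0 <= sqn v.
Proof. by apply: sumr_ge0 => i _; exact: sqr_ge0. Qed.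

Lemma sqnZ (I : finType) (a : R) (v : I -> R) :
  sqn (fun i => a * v i) = a ^+ 2 * sqn v.
Proof. by rewrite /sqn mulr_sumr; apply: eq_bigr => i _; rewrite exprMn. Qed.

Lemma bilinT (I : finType) (A : I -> I -> R) v w :
  bilin (fun i j => A j i) v w = bilin A w v.
Proof.
rewrite /bilin exchange_big; apply: eq_bigr => i _; apply: eq_bigr => j _ /=.
by rewrite mulrAC.
Qed.

Lemma contractionT (I : finType) (A : I -> I -> R) :
  contraction A -> contraction (fun i j => A j i).
Proof. by move=> cA v w; rewrite bilinT addrC. Qed.

(* [g] is a Herz-Schur multiplier of norm at most [c]. *)
Definition schur (G : groupType) (g : G -> R) (c : R) : Prop :=
  forall (I : finType) (p q : I -> G) (A : I -> I -> R), contraction A ->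
  forall v w, bilin (fun i j => A i j * g (p i * (q j)^-1)%g) v w
    <= c * ((sqn v + sqn w) / 2).

Section SchurTheory.
Variable G : groupType.
Implicit Types g h : G -> R.

Lemma schur_eq g h c : g =1 h -> schur g c -> schur h c.
Proof. by move=> /funext ->. Qed.

Lemma schurD g h c d : schur g c -> schur h d ->
  schur (fun x => g x + h x) (c + d).
Proof.
move=> sg sh I p q A cA v w; rewrite mulrDl.
apply: le_trans (lerD (sg I p q A cA v w) (sh I p q A cA v w)).
rewrite /bilin -big_split ler_sum// => i _; rewrite -big_split ler_sum// => j _.
by rewrite le_eqVlt; apply/orP; left; apply/eqP => /=; ring.
Qed.

Lemma schur_trans_r g c t : schur g c -> schur (fun x => g (x * t)%g) c.
Proof.
move=> sg I p q A cA v w.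
apply: le_trans (sg I p (fun j => t^-1 * q j)%g A cA v w).
rewrite /bilin ler_sum// => i _; rewrite ler_sum// => j _.
by rewrite invgM invgK mulgA.
Qed.

Lemma schurV g c : schur g c -> schur (fun x => g x^-1%g) c.
Proof.
move=> sg I p q A cA v w.
have := sg I q p _ (contractionT cA) w v.
rewrite -bilinT [X in _ * (X / 2)]addrC; apply: le_trans.
rewrite /bilin ler_sum// => i _; rewrite ler_sum// => j _.
by rewrite invgM invgK.
Qed.

Lemma schur_le g c d : c <= d -> schur g c -> schur g d.
Proof.
move=> cd sg I p q A cA v w; apply: le_trans (sg I p q A cA v w) _.
by rewrite ler_wpM2r// divr_ge0// addr_ge0// sqn_ge0.
Qed.

(** Weighted AM-GM turns an operator norm bound [c] into the bilinear form: the pairing of [x] with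
    [w] is at most [c / 2] times the sum of the squared norms of [c^-1 x] and [w]. *)
Lemma schur_of_sqn g c : 0 < c ->
  (forall (I : finType) (p q : I -> G) (A : I -> I -> R), contraction A ->
   forall v, sqn (fun i => \sum_j A i j * g (p i * (q j)^-1)%g * v j)
     <= c ^+ 2 * sqn v) -> schur g c.
Proof.
move=> c0 gc I p q A cA v w.
set x := fun i => \sum_j A i j * g (p i * (q j)^-1)%g * v j.
have -> : bilin (fun i j => A i j * g (p i * (q j)^-1)%g) v w = \sum_i x i * w i.
  by apply: eq_bigr => i _; rewrite /x mulr_suml.
apply: (@le_trans _ _ (c / 2 * (c^-1 ^+ 2 * sqn x + sqn w))).
  rewrite -sqnZ /sqn -big_split mulr_sumr; apply: ler_sum => i _ /=.
  have := sqr_ge0 (c^-1 * x i - w i).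
  have -> : x i * w i = c / 2 * (2 * (c^-1 * x i) * w i) by field; rewrite gt_eqF.
  by rewrite ler_pM2l ?divr_gt0//; lra.
have xv : c^-1 ^+ 2 * sqn x <= sqn v.
  by rewrite exprVn mulrC ler_pdivrMr ?exprn_gt0// mulrC gc.
by rewrite mulrAC -mulrA ler_pM2l//; lra.
Qed.

(** The product of the orthogonal matrix with rows (1, 1) and (1, -1), divided by the square root of
    2, and the block diagonal matrix with blocks 1 and [A]. *)
Definition block (I : finType) (A : I -> I -> R) (x y : I + I) : R :=
  (Num.sqrt 2)^-1 * match x, y with
  | inl i, inl j | inr i, inl j => (i == j)%:R
  | inl i, inr j => A i j
  | inr i, inr j => - A i j
  end.

Lemma bilin_sum (I : finType) (B : I + I -> I + I -> R) v w :
  bilin B v w = \sum_i ((\sum_j B (inl i) (inl j) * v (inl j) * w (inl i)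
                      + \sum_j B (inl i) (inr j) * v (inr j) * w (inl i))
                      + (\sum_j B (inr i) (inl j) * v (inl j) * w (inr i)
                      + \sum_j B (inr i) (inr j) * v (inr j) * w (inr i))).
Proof.
rewrite /bilin big_sumType /= -big_split; apply: eq_bigr => i _ /=.
by rewrite !big_sumType.
Qed.

Lemma sqn_sum (I : finType) (v : I + I -> R) :
  sqn v = sqn (v \o inl) + sqn (v \o inr).
Proof. by rewrite /sqn big_sumType. Qed.

Lemma sum_delta (I : finType) (i : I) (F : I -> R) :
  \sum_j (i == j)%:R * F j = F i.
Proof.
rewrite (bigD1 i)//= eqxx mul1r big1 ?addr0// => j.
by rewrite eq_sym => /negbTE ->; rewrite mul0r.
Qed.

Lemma sqrt2V : (Num.sqrt 2)^-1 ^+ 2 = 2^-1 :> R.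
Proof. by rewrite exprVn sqr_sqrtr. Qed.

(** The orthogonal factor of [block A] is moved onto [w], giving the pair [a], [b] with the same
    total norm; the identity block then pairs with [a] and [A] with [b]. *)
Lemma block_contraction (I : finType) (A : I -> I -> R) :
  contraction A -> contraction (block A).
Proof.
move=> cA v w; set r : R := (Num.sqrt 2)^-1.
pose a i := r * (w (inl i) + w (inr i)); pose b i := r * (w (inl i) - w (inr i)).
have -> : bilin (block A) v w = \sum_i v (inl i) * a i + bilin A (v \o inr) b.
  rewrite bilin_sum /bilin -big_split; apply: eq_bigr => i _ /=.
  rewrite /block -/r.
  under eq_bigr do rewrite mulrAC mulrC.
  under [X in _ + (X + _)]eq_bigr do rewrite mulrAC mulrC.
  have E F c : \sum_j F j * (r * (i == j)%:R * c) = F i * r * c :> R.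
    rewrite -[RHS](sum_delta i (fun j => F j * r * c)).
    by apply: eq_bigr => j _; ring.
  rewrite !E.
  have -> : \sum_j r * A i j * v (inr j) * w (inl i) =
            r * w (inl i) * \sum_j A i j * v (inr j).
    by rewrite mulr_sumr; apply: eq_bigr => j _; ring.
  have -> : \sum_j r * - A i j * v (inr j) * w (inr i) =
            - r * w (inr i) * \sum_j A i j * v (inr j).
    by rewrite mulr_sumr; apply: eq_bigr => j _; ring.
  have -> : \sum_j A i j * v (inr j) * b i =
            b i * \sum_j A i j * v (inr j).
    by rewrite mulr_sumr; apply: eq_bigr => j _; ring.
  by rewrite /a /b; ring.
have Eab : sqn a + sqn b = sqn w.
  rewrite sqn_sum /sqn -!big_split; apply: eq_bigr => k _ /=.
  by rewrite /a /b !exprMn sqrt2V; lra.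
have : \sum_i v (inl i) * a i <= (sqn (v \o inl) + sqn a) / 2.
  rewrite /sqn -big_split mulr_suml ler_sum// => i _ /=.
  by have := sqr_ge0 (v (inl i) - a i); lra.
have := cA (v \o inr) b; rewrite -Eab (sqn_sum v); lra.
Qed.

(* The Schur multiplier by [g] is applied to [block A], with rows indexed by
   [t p_i], [p_i] and columns by [p_i], [q_j]: the first column becomes almost an
   isometry times [g], leaving no room for the second one. *)
Lemma schur_near_invariant g rho t : 0 < rho -> rho <= 1 ->
  schur g (1 + rho ^+ 2) -> 1 - rho ^+ 2 <= g 1%g -> 1 - rho ^+ 2 <= g t ->
  schur (fun x => g (t * x)%g - g x) (8 * rho).
Proof.
move=> rho0 rho1 sg g1 gt I p q A cA v w.
pose c := 1 + rho ^+ 2.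
pose P (x : I + I) := match x with inl i => t * p i | inr i => p i end%g.
pose Q (x : I + I) := match x with inl i => p i | inr i => q i end%g.
set r : R := (Num.sqrt 2)^-1.
(* The first column has a defect of order [rho ^+ 2]. With weight [rho^-1] on it, that defect and
   the cost of the second column both end up of order [rho]. *)
pose al := rho^-1.
pose V (x : I + I) := match x with inl i => al * w i | inr i => v i end.
(* [W] is the image under [block A] of the first column part of [V], so that this part alone nearly
   exhausts the norm bound. *)
pose W (x : I + I) := match x with inl i => r * al * w i | inr i => r * al * w i end.
have := sg _ P Q _ (block_contraction cA) V W.
set X := bilin (fun i j => A i j * _) v w.
have -> : bilin (fun i j => block A i j * g (P i * (Q j)^-1)%g) V W =
   al / 2 * (al * sqn w * (g t + g 1%g) + X).
  rewrite bilin_sum /X /bilin /sqn mulr_sumr mulr_suml -big_split mulr_sumr.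
  apply: eq_bigr => i _ /=; rewrite /block /V /W -/r.
  have E c' (d : I -> R) : \sum_j r * (i == j)%:R * d j * (al * w j) * c' =
     r * d i * (al * w i) * c' :> R.
    rewrite -[RHS](sum_delta i (fun j => r * d j * (al * w j) * c')).
    by apply: eq_bigr => j _; ring.
  rewrite (E _ (fun j => g (t * p i * (p j)^-1)%g)).
  rewrite (E _ (fun j => g (p i * (p j)^-1)%g)) mulgK mulgV.
  rewrite -addrA [X in _ + X]addrCA -big_split.
  have -> : (\sum_j (r * A i j * g (t * p i * (q j)^-1)%g * v j * (r * al * w i)
      + r * - A i j * g (p i * (q j)^-1)%g * v j * (r * al * w i)))
    = al / 2 * \sum_j A i j * (g (t * (p i * (q j)^-1))%g - g (p i * (q j)^-1)%g)
       * v j * w i.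
    rewrite mulr_sumr; apply: eq_bigr => j _; rewrite -sqrt2V -/r mulgA; ring.
  rewrite -sqrt2V -/r; ring.
have -> : sqn V = al ^+ 2 * sqn w + sqn v by rewrite sqn_sum -sqnZ.
have -> : sqn W = al ^+ 2 * sqn w.
  rewrite sqn_sum; rewrite (_ : W \o inr = W \o inl); last exact/funext.
  rewrite (_ : W \o inl = fun i => r * al * w i); last exact/funext.
  by rewrite sqnZ exprMn sqrt2V; lra.
have al0 : 0 < al by rewrite invr_gt0.
have alr : al * rho = 1 by rewrite mulVf ?gt_eqF.
have w0 := sqn_ge0 w; have v0 := sqn_ge0 v.
move=> H.
have {}H : al * (al * sqn w * (g t + g 1%g) + X)
    <= al * (c * (2 * al * sqn w + rho * sqn v)).
  apply: (@le_trans _ _ (c * (2 * al ^+ 2 * sqn w + (al * rho) * sqn v))).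
    rewrite alr; rewrite /c in H *; lra.
  by rewrite le_eqVlt; apply/orP; left; apply/eqP; ring.
rewrite ler_pM2l// in H.
have H2 : al * sqn w * (2 - 2 * rho ^+ 2) <= al * sqn w * (g t + g 1%g).
  rewrite ler_wpM2l//; last lra.
  by rewrite mulr_ge0// ltW.
have H3 : al * sqn w * rho ^+ 2 = rho * sqn w.
  by rewrite -[RHS]mul1r -alr; ring.
have r2 : rho ^+ 2 <= 1 by rewrite expr_le1// ltW.
have H4 : c * (rho * sqn v) <= 2 * (rho * sqn v).
  by rewrite ler_wpM2r ?mulr_ge0 ?(ltW rho0)// /c; lra.
have H5 : 0 <= rho * sqn v by rewrite mulr_ge0// ltW.
have H6 : c * (2 * al * sqn w) = 2 * (al * sqn w) + 2 * (rho * sqn w).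
  by rewrite /c -H3; ring.
have H7 : c * (2 * al * sqn w + rho * sqn v)
    = c * (2 * al * sqn w) + c * (rho * sqn v) by rewrite mulrDr.
by move: H; rewrite H7 H6; lra.
Qed.

(** Left almost invariance, translated on the right by [t^-1], is added to right almost invariance;
    the latter is left almost invariance of [x |-> g x^-1]. *)
Lemma schur_near_conj_invariant g rho t : 0 < rho -> rho <= 1 ->
  schur g (1 + rho ^+ 2) -> 1 - rho ^+ 2 <= g 1%g -> 1 - rho ^+ 2 <= g t ->
  1 - rho ^+ 2 <= g t^-1%g ->
  schur (fun x => g (t * x * t^-1)%g - g x) (16 * rho).
Proof.
move=> rho0 rho1 sg g1 gt gtV.
have sl := schur_trans_r t^-1%g (schur_near_invariant rho0 rho1 sg g1 gt).
have sr : schur (fun x => g (x * t^-1)%g - g x) (8 * rho).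
  have sgV := schurV sg.
  have := @schur_near_invariant _ rho t rho0 rho1 sgV; rewrite invg1.
  move=> /(_ g1 gtV) /schurV.
  by apply: schur_eq => x; rewrite invgM !invgK.
have -> : 16 * rho = 8 * rho + 8 * rho by ring.
by apply: schur_eq (schurD sl sr) => x; rewrite mulgA; ring.
Qed.

End SchurTheory.
End Schur.

(** * Walsh transform and spectral measure *)

Section Walsh.
Variables (R : realType) (S : finType).
Local Notation cube := {ffun S -> bool}.
Local Notation N := (2 ^+ #|S| : R).
Implicit Types k p q y : cube.

(** The Walsh functions: characters of the group of subsets of [S] under symmetric difference, whose
    dual is identified with the cube itself. *)
Definition chi k p : R := \prod_i (-1) ^+ (k i && p i).

Definition cube0 : cube := [ffun=> false].
Definition cube1 (i0 : S) : cube := [ffun i => i == i0].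
Definition cxor p q : cube := [ffun i => p i (+) q i].
Definition cperm (sg : {perm S}) p : cube := [ffun i => p (sg i)].

Lemma N_gt0 : 0 < N. Proof. by rewrite exprn_gt0. Qed.

Lemma N_neq0 : N != 0. Proof. by rewrite gt_eqF// N_gt0. Qed.

Lemma chiC k p : chi k p = chi p k.
Proof. by apply: eq_bigr => i _; rewrite andbC. Qed.

Lemma chi0 k : chi k cube0 = 1.
Proof. by rewrite /chi big1// => i _; rewrite ffunE andbF. Qed.

Lemma chi_xor k p q : chi k (cxor p q) = chi k p * chi k q.
Proof.
rewrite /chi -big_split; apply: eq_bigr => i _ /=.
by rewrite ffunE -signr_addb; case: (k i); case: (p i); case: (q i).
Qed.

Lemma cxorI p q : cxor p (cxor p q) = q.
Proof. by apply/ffunP => i; rewrite !ffunE addbA addbb. Qed.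

Lemma cxor_inj p : injective (cxor p).
Proof. exact: can_inj (cxorI p). Qed.

Lemma chi_sqr k p : chi k p ^+ 2 = 1.
Proof. by rewrite expr2 /chi -big_split big1//= => i _; rewrite -expr2 sqrr_sign. Qed.

Lemma cpermK sg : cancel (cperm sg) (cperm sg^-1%g).
Proof. by move=> p; apply/ffunP => i; rewrite !ffunE permKV. Qed.

Lemma cperm_inj sg : injective (cperm sg).
Proof. exact: can_inj (cpermK sg). Qed.

Lemma chi_perm sg k p : chi (cperm sg k) (cperm sg p) = chi k p.
Proof.
rewrite [RHS](reindex_inj (@perm_inj _ sg)).
by apply: eq_bigr => i _; rewrite !ffunE.
Qed.

(** The sum over the cube factors over the coordinates, and a coordinate where [p] and [q] differ
    contributes the factor 1 - 1. *)
Lemma chi_orth p q : \sum_k chi k p * chi k q = (p == q)%:R * N.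
Proof.
transitivity (\prod_(i : S) \sum_(b : bool) (-1 : R) ^+ (b && (p i (+) q i))).
  rewrite bigA_distr_bigA; apply: eq_bigr => k _.
  by rewrite -chi_xor; apply: eq_bigr => i _; rewrite ffunE.
have [->|pq] := eqVneq p q.
  rewrite mul1r -prodr_const; apply: eq_bigr => i _.
  by rewrite big_bool /= addbb.
have [i pqi] : exists i, p i != q i.
  by apply/existsP; apply: contra_neqT pq => /existsPn pq; apply/ffunP => i;
    apply/eqP; have := pq i; rewrite negbK.
rewrite mul0r (bigD1 i)//= big_bool /=.
by move: pqi; case: (p i); case: (q i) => //= _; rewrite expr1 expr0 addNr mul0r.
Qed.

Definition walsh (v : cube -> R) k : R := \sum_p chi k p * v p.

Lemma parseval v : sqn (walsh v) = N * sqn v.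
Proof.
rewrite /sqn /walsh.
transitivity (\sum_k \sum_p \sum_q v p * v q * (chi k p * chi k q)).
  apply: eq_bigr => k _; rewrite expr2 mulr_suml; apply: eq_bigr => p _.
  by rewrite mulr_sumr; apply: eq_bigr => q _; ring.
rewrite exchange_big mulr_sumr; apply: eq_bigr => p _ /=.
rewrite exchange_big (bigD1 p)//= -mulr_sumr chi_orth eqxx big1.
  by rewrite mul1r addr0; ring.
by move=> q qp; rewrite -mulr_sumr chi_orth eq_sym (negbTE qp) mul0r mulr0.
Qed.

(* [<K e_k, e_k>] for the orthonormal Walsh basis [e_k = chi_k / sqrt N] *)
Definition walsh_diag (K : cube -> cube -> R) k : R :=
  N^-1 * \sum_p \sum_q chi k p * chi k q * K p q.

(** The multiplier is tested on the contraction [A] that is diagonal in the Walsh basis with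
    eigenvalues the signs of [walsh_diag K], both vectors being constantly 1. *)
Lemma walsh_diag_l1 (K : cube -> cube -> R) c :
  (forall A, contraction A -> forall v w,
    bilin (fun p q => A p q * K p q) v w <= c * ((sqn v + sqn w) / 2)) ->
  \sum_k `|walsh_diag K k| <= c * N.
Proof.
move=> HK; pose s k := Num.sg (walsh_diag K k).
have s1 k : `|s k| <= 1 by rewrite normr_sg; case: (_ != 0).
pose A p q := N^-1 * \sum_k s k * (chi k p * chi k q).
have cA : contraction A.
  move=> v w.
  have -> : bilin A v w = N^-1 * \sum_k s k * (walsh v k * walsh w k).
    transitivity (\sum_p \sum_q \sum_k N^-1 * s k * (chi k q * v q) * (chi k p * w p)).
      apply: eq_bigr => p _; apply: eq_bigr => q _.
      rewrite /A mulr_sumr !mulr_suml; apply: eq_bigr => k _; ring.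
    under eq_bigr do rewrite exchange_big.
    rewrite exchange_big mulr_sumr; apply: eq_bigr => k _ /=.
    rewrite /walsh mulrA mulrA mulr_sumr; apply: eq_bigr => p _.
    by rewrite !mulr_sumr mulr_suml; apply: eq_bigr => q _; ring.
  rewrite mulrC ler_pdivrMr ?N_gt0//.
  have -> : (sqn v + sqn w) / 2 * N = (sqn (walsh v) + sqn (walsh w)) / 2.
    rewrite !parseval; ring.
  rewrite /sqn -big_split mulr_suml ler_sum// => k _.
  apply: le_trans (ler_norm _) _; rewrite normrM.
  apply: (@le_trans _ _ `|walsh v k * walsh w k|).
    by rewrite -[leRHS]mul1r ler_wpM2r.
  rewrite normrM -[X in _ <= (X + _) / 2]real_normK ?num_real//.
  rewrite -[X in _ <= (_ + X) / 2]real_normK ?num_real//.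
  by have := sqr_ge0 (`|walsh v k| - `|walsh w k|); lra.
have := HK A cA (fun=> 1) (fun=> 1).
have -> : @sqn R {ffun S -> bool} (fun=> 1) = N.
  rewrite /sqn; under eq_bigr do rewrite expr1n.
  by rewrite sumr_const card_ffun card_bool natrX.
have -> : (N + N) / 2 = N by lra.
apply: le_trans; rewrite le_eqVlt; apply/orP; left; apply/eqP.
transitivity (\sum_k s k * walsh_diag K k).
  by apply: eq_bigr => k _; rewrite [LHS]normrEsg.
transitivity (\sum_p \sum_q \sum_k N^-1 * s k * (chi k p * chi k q) * K p q).
  transitivity (\sum_k \sum_p \sum_q N^-1 * s k * (chi k p * chi k q) * K p q).
    apply: eq_bigr => k _; rewrite /walsh_diag mulrA mulr_sumr.
    apply: eq_bigr => p _; rewrite mulr_sumr; apply: eq_bigr => q _; ring.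
  by rewrite exchange_big; apply: eq_bigr => p _; rewrite exchange_big.
apply: eq_bigr => p _; apply: eq_bigr => q _.
rewrite /A !mulr1 mulr_sumr mulr_suml; apply: eq_bigr => k _; ring.
Qed.

(** Orthogonality of characters keeps only [q = cxor p y]. When [K] is the kernel of a function on a
    group, this recovers its values on differences by [y]. *)
Lemma sum_walsh_diag (K : cube -> cube -> R) y :
  \sum_k walsh_diag K k * chi k y = \sum_p K p (cxor p y).
Proof.
transitivity (\sum_k \sum_p \sum_q N^-1 * K p q * (chi k (cxor p y) * chi k q)).
  apply: eq_bigr => k _; rewrite /walsh_diag mulr_sumr mulr_suml.
  apply: eq_bigr => p _; rewrite mulr_sumr mulr_suml.
  by apply: eq_bigr => q _; rewrite chi_xor; ring.
rewrite exchange_big; apply: eq_bigr => p _ /=.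
rewrite exchange_big (bigD1 (cxor p y))//= -mulr_sumr chi_orth eqxx big1.
  by rewrite mul1r addr0 -mulrA mulrCA mulVf ?N_neq0// mulr1.
by move=> q; rewrite eq_sym => qp; rewrite -mulr_sumr chi_orth (negbTE qp) mul0r mulr0.
Qed.

Lemma walsh_diag_perm sg (K : cube -> cube -> R) k :
  walsh_diag (fun p q => K (cperm sg p) (cperm sg q)) k =
  walsh_diag K (cperm sg k).
Proof.
congr (_ * _); rewrite [RHS](reindex_inj (@cperm_inj sg)).
apply: eq_bigr => p _; rewrite [RHS](reindex_inj (@cperm_inj sg)).
by apply: eq_bigr => q _; rewrite !chi_perm.
Qed.

Lemma walsh_diagB (K L : cube -> cube -> R) k :
  walsh_diag (fun p q => K p q - L p q) k = walsh_diag K k - walsh_diag L k.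
Proof.
rewrite /walsh_diag -mulrBr -sumrB; congr (_ * _); apply: eq_bigr => p _.
by rewrite -sumrB; apply: eq_bigr => q _; rewrite mulrBr.
Qed.

(** Flipping bit [i] of [k] multiplies [chi k p * chi k q] by a sign which is 1 as soon as
    [p i = q i]. *)
Lemma walsh_diag_flip (K : cube -> cube -> R) i k :
  (forall p q, p i != q i -> K p q = 0) ->
  walsh_diag K (cxor (cube1 i) k) = walsh_diag K k.
Proof.
move=> K0; congr (_ * _); apply: eq_bigr => p _; apply: eq_bigr => q _.
have [pq|/K0 ->] := eqVneq (p i) (q i); last by rewrite !mulr0.
congr (_ * _); rewrite -!chi_xor chiC chi_xor [X in _ * X]chiC.
rewrite /chi [X in X * _](_ : _ = 1) ?mul1r// big1// => j _; rewrite !ffunE.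
by case: eqP => [->|]; rewrite ?pq ?addbb ?andbF.
Qed.

(** * The measure given by the squared Walsh transform of the square root of [|F|] *)

Section SpectralMeasure.
Variable F : cube -> R.

Let xi k := Num.sqrt `|F k|.
Definition spec y : R := (N^-1 * walsh xi y) ^+ 2.

Let xi2 k : xi k ^+ 2 = `|F k|. Proof. by rewrite sqr_sqrtr. Qed.

Lemma spec_ge0 y : 0 <= spec y. Proof. exact: sqr_ge0. Qed.

Lemma sum_spec : \sum_y spec y = N^-1 * \sum_k `|F k|.
Proof.
under eq_bigr do rewrite /spec exprMn.
rewrite -mulr_sumr -/(sqn _) parseval expr2 mulrA mulfVK ?N_neq0//.
by congr (_ * _); apply: eq_bigr => k _.
Qed.


(** The substitution of [cxor (cube1 i) k] for [k] fixes [xi] and changes the sign of [chi y k], so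
    the transform at [y] equals its own negative. *)
Lemma spec_eq0 i y : (forall k, F (cxor (cube1 i) k) = F k) -> y i -> spec y = 0.
Proof.
move=> Fi yi; suff : walsh xi y = - walsh xi y.
  rewrite /spec => E; suff -> : walsh xi y = 0 by rewrite mulr0 expr0n.
  by apply/eqP; move/eqP: E; rewrite -addr_eq0 -mulr2n mulrn_eq0.
rewrite {1}/walsh (reindex_inj (@cxor_inj (cube1 i))) -sumrN.
apply: eq_bigr => k _; rewrite /xi Fi chi_xor -mulNr; congr (_ * _).
suff -> : chi y (cube1 i) = -1 by rewrite mulN1r.
rewrite /chi (bigD1 i)//= ffunE eqxx yi big1 ?mulr1// => j /negbTE ji.
by rewrite ffunE ji andbF.
Qed.

Lemma walsh_perm sg y :
  walsh xi (cperm sg y) = walsh (fun k => xi (cperm sg k)) y.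
Proof.
rewrite /walsh (reindex_inj (@cperm_inj sg)).
by apply: eq_bigr => k _; rewrite chi_perm.
Qed.

(** The Powers-Stormer inequality for scalars: a difference of square roots is bounded by their
    sum. *)
Lemma sqr_sqrt_dist (a b : R) : 0 <= a -> 0 <= b ->
  (Num.sqrt a - Num.sqrt b) ^+ 2 <= `|a - b|.
Proof.
move=> a0 b0; have ra := sqrtr_ge0 a; have rb := sqrtr_ge0 b.
rewrite -{2}(sqr_sqrtr a0) -{2}(sqr_sqrtr b0) subr_sqr normrM.
rewrite -[leLHS]real_normK ?num_real// expr2 ler_wpM2l// [leRHS]ger0_norm ?addr_ge0//.
by rewrite ler_norml; apply/andP; split; lra.
Qed.

(** With [spec = a ^+ 2], each term factors as [|b - a| * |b + a|]. Parseval and [sqr_sqrt_dist]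
    bound the squared norm of [b - a] by [16 * th ^+ 2], that of [b + a] is at most 8, and AM-GM
    with weight [th] gives [8 * th + 4 * th]. *)
Lemma spec_close sg th : 0 < th -> \sum_k `|F k| <= 2 * N ->
  \sum_k `|F (cperm sg k) - F k| <= 16 * th ^+ 2 * N ->
  \sum_y `|spec (cperm sg y) - spec y| <= 12 * th.
Proof.
move=> th0 F2 HF.
pose a y := N^-1 * walsh xi y.
pose b y := N^-1 * walsh xi (cperm sg y).
have sumP : \sum_y spec y <= 2 by rewrite sum_spec mulrC ler_pdivrMr ?N_gt0.
have Ea : \sum_y a y ^+ 2 = \sum_y spec y by [].
have Eb : \sum_y b y ^+ 2 = \sum_y spec y.
  by rewrite [RHS](reindex_inj (@cperm_inj sg)).
have D : \sum_y (b y - a y) ^+ 2 <= 16 * th ^+ 2.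
  pose d k := xi (cperm sg k) - xi k.
  have -> : \sum_y (b y - a y) ^+ 2 = N^-1 * sqn d.
    transitivity (sqn (fun y => N^-1 * walsh d y)).
      apply: eq_bigr => y _; congr (_ ^+ 2).
      rewrite /b /a walsh_perm -mulrBr; congr (_ * _).
      by rewrite /walsh -sumrB; apply: eq_bigr => k _; rewrite mulrBr.
    by rewrite sqnZ parseval expr2 mulrA mulfVK ?N_neq0.
  rewrite mulrC ler_pdivrMr ?N_gt0//; apply: le_trans HF.
  apply: ler_sum => k _; apply: le_trans (sqr_sqrt_dist _ _) _ => //.
  exact: ler_dist_dist.
have E : \sum_y (b y + a y) ^+ 2 <= 8.
  apply: (@le_trans _ _ (\sum_y (2 * b y ^+ 2 + 2 * a y ^+ 2))).
    by apply: ler_sum => y _; have := sqr_ge0 (b y - a y); lra.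
  by rewrite big_split /= -!mulr_sumr Ea Eb; lra.
apply: (@le_trans _ _ (\sum_y (th^-1 / 2 * (b y - a y) ^+ 2
                               + th / 2 * (b y + a y) ^+ 2))).
  apply: ler_sum => y _; rewrite /spec -/(a y) -/(b y) subr_sqr normrM.
  rewrite -[in leRHS]real_normK ?num_real//.
  rewrite -[X in _ <= _ + _ * X]real_normK ?num_real//.
  set s := `|b y - a y|; set t := `|b y + a y|.
  have := sqr_ge0 (s - th * t).
  have -> : s * t = (th^-1 / 2) * (2 * th * s * t).
    by field; rewrite gt_eqF.
  have -> : th / 2 * t ^+ 2 = th^-1 / 2 * (th * t) ^+ 2.
    by field; rewrite gt_eqF.
  rewrite -mulrDr ler_pM2l ?divr_gt0 ?invr_gt0//; lra.
rewrite big_split /= -!mulr_sumr.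
have -> : 12 * th = th^-1 / 2 * (16 * th ^+ 2) + th / 2 * 8.
  by field; rewrite gt_eqF.
by rewrite lerD// ler_wpM2l// ltW// divr_gt0// invr_gt0.
Qed.

(** [|F|] is concentrated where [chi k e] is 1, so the transform of [xi] takes nearly the same value
    at [cube0] and at [e]. Hence [cube0] cannot carry almost all of the mass, which is nearly 1. *)
Lemma spec_mass rho i0 : 0 < rho -> 10 * rho <= 1 ->
  \sum_k `|F k| <= (1 + rho ^+ 2) * N -> (1 - rho ^+ 2) * N <= \sum_k F k ->
  (1 - rho ^+ 2) * N <= \sum_k F k * chi k (cube1 i0) ->
  1 / 4 <= \sum_(y | y != cube0) spec y.
Proof.
move=> rho0 rho1 F1 F2 F3.
set e := cube1 i0 in F3 *.
have e0 : e != cube0.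
  by apply/eqP => /ffunP /(_ i0); rewrite !ffunE eqxx.
have chi_le k : -1 <= chi k e <= 1.
  by rewrite -ler_norml -(@ler_pXn2r _ 2) ?nnegrE// real_normK ?num_real// chi_sqr expr1n.
have mass : 1 - rho ^+ 2 <= \sum_y spec y.
  rewrite sum_spec mulrC ler_pdivlMr ?N_gt0//.
  by apply: le_trans F2 _; apply: ler_sum => k _; exact: ler_norm.
have Fchi : \sum_k `|F k| * (1 - chi k e) <= 4 * rho ^+ 2 * N.
  have : \sum_k F k + \sum_k F k * chi k e <= \sum_k `|F k| * (1 + chi k e).
    rewrite -big_split ler_sum// => k _ /=.
    have -> : F k + F k * chi k e = F k * (1 + chi k e) by ring.
    by rewrite ler_wpM2r ?ler_norm//; have := chi_le k; lra.
  have -> : \sum_k `|F k| * (1 - chi k e) =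
     2 * (\sum_k `|F k|) - \sum_k `|F k| * (1 + chi k e).
    by rewrite mulr_sumr -sumrB; apply: eq_bigr => k _; ring.
  lra.
pose d := \sum_k xi k * (1 - chi k e).
have d0 : 0 <= d.
  apply: sumr_ge0 => k _; rewrite mulr_ge0 ?sqrtr_ge0//.
  by have := chi_le k; lra.
have d3 : d <= 3 * rho * N.
  (* AM-GM replaces [xi k] by [xi k ^+ 2 / (2 * rho) + rho / 2]. By [Fchi] the first part
     contributes at most [2 * rho * N], and the second at most [rho * N] since
     [1 - chi k e <= 2]. *)
  apply: (@le_trans _ _ (\sum_k (rho^-1 / 2 * (`|F k| * (1 - chi k e)) + rho))).
    apply: ler_sum => k _; have [c1 c2] := andP (chi_le k).
    have := sqr_ge0 (xi k - rho).
    rewrite -xi2 => H.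
    have E : xi k <= rho^-1 / 2 * xi k ^+ 2 + rho / 2.
      have -> : rho / 2 = rho^-1 / 2 * rho ^+ 2 by field; rewrite gt_eqF.
      rewrite -mulrDr.
      have {1}-> : xi k = rho^-1 / 2 * (2 * rho * xi k) by field; rewrite gt_eqF.
      by rewrite ler_pM2l ?divr_gt0 ?invr_gt0//; lra.
    apply: (@le_trans _ _ ((rho^-1 / 2 * xi k ^+ 2 + rho / 2) * (1 - chi k e))).
      by rewrite ler_wpM2r//; lra.
    have : rho / 2 * (1 - chi k e) <= rho / 2 * 2 by rewrite ler_wpM2l//; lra.
    lra.
  rewrite big_split /= -mulr_sumr sumr_const card_ffun card_bool -[rho *+ _]mulr_natr natrX.
  have : rho^-1 / 2 * \sum_k `|F k| * (1 - chi k e) <=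
         rho^-1 / 2 * (4 * rho ^+ 2 * N).
    by rewrite ler_wpM2l// ltW// divr_gt0// invr_gt0.
  have -> : rho^-1 / 2 * (4 * rho ^+ 2 * N) = 2 * rho * N.
    by field; rewrite gt_eqF.
  lra.
pose x0 := N^-1 * walsh xi cube0; pose x1 := N^-1 * walsh xi e.
have E01 : x0 - x1 = N^-1 * d.
  rewrite -mulrBr -sumrB; congr (_ * _); apply: eq_bigr => k _.
  by rewrite chiC chi0 [chi e _]chiC; ring.
have D0 : 0 <= x0 - x1 by rewrite E01 mulr_ge0// invr_ge0 ltW// N_gt0.
have D3 : x0 - x1 <= 3 * rho by rewrite E01 mulrC ler_pdivrMr ?N_gt0.
have P1 : x1 ^+ 2 <= \sum_(y | y != cube0) spec y.
  by rewrite (bigD1 e)//= lerDl sumr_ge0// => y _; exact: spec_ge0.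
have P0 : \sum_y spec y = x0 ^+ 2 + \sum_(y | y != cube0) spec y.
  by rewrite (bigD1 cube0).
have D2 : (x0 - x1) ^+ 2 <= 9 * rho ^+ 2.
  have -> : 9 * rho ^+ 2 = (3 * rho) ^+ 2 by ring.
  by rewrite ler_pXn2r ?nnegrE// mulr_ge0// ltW.
have r2 : rho ^+ 2 <= 1 / 100.
  have -> : 1 / 100 = (1 / 10) ^+ 2 :> R by field.
  by rewrite ler_pXn2r ?nnegrE//; lra.
(* This square says [x0 ^+ 2 <= 2 * (x0 - x1) ^+ 2 + 2 * x1 ^+ 2]. Hence [1 - rho ^+ 2] is at most
   [18 * rho ^+ 2] plus three times the mass off [cube0]. *)
have := sqr_ge0 (x0 - 2 * x1); lra.
Qed.

End SpectralMeasure.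
End Walsh.

(** * Almost invariant means from Schur multipliers on the wreath product *)

Section PermExtension.
Variable S : finType.

(** The complements of [A] and of its image have equal cardinality and are matched through their
    enumerations. *)
Lemma perm_extension (A : {set S}) (f : S -> S) : {in A &, injective f} ->
  exists sg : {perm S}, {in A, sg =1 f}.
Proof.
move=> fA.
have cc : #|~: A| = #|~: (f @: A)|.
  apply/eqP; rewrite -(eqn_add2l #|A|) cardsC -(card_in_imset fA) cardsC.
  by [].
pose B := ~: (f @: A).
have idxlt i : i \notin A -> (index i (enum (~: A)) < size (enum B))%N.
  by move=> iA; rewrite -cardE -cc cardE index_mem mem_enum inE.
pose h i := if i \in A then f i else nth i (enum B) (index i (enum (~: A))).
have hB i : i \notin A -> h i \in B.
  by move=> iA; rewrite /h (negbTE iA) -mem_enum mem_nth// idxlt.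
have hI : injective h.
  move=> i j; have [iA|iA] := boolP (i \in A); have [jA|jA] := boolP (j \in A).
  - by rewrite /h iA jA => /fA; apply.
  - move=> E; have := hB _ jA; rewrite -E /h iA inE => /negP; case.
    exact: imset_f.
  - move=> E; have := hB _ iA; rewrite E /h jA inE => /negP; case.
    exact: imset_f.
  - rewrite /h (negbTE iA) (negbTE jA) (set_nth_default j i) ?idxlt// => /eqP.
    rewrite nth_uniq ?idxlt ?enum_uniq// => /eqP E.
    have jE : j \in enum (~: A) by rewrite mem_enum inE.
    have iE : i \in enum (~: A) by rewrite mem_enum inE.
    by rewrite -(nth_index j iE) E nth_index.
by exists (perm hI) => i iA; rewrite permE /h iA.
Qed.

End PermExtension.

Section ApproxMean.
Variables (R : realType) (G : groupType).

(** Linearity and positivity are asked on all functions, bounded or not, because the means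
    constructed below are finite averages. *)
Definition approx_mean (T : seq G) (eps : R) (m : (G -> R) -> R) : Prop :=
  [/\ forall (a : R) (u v : G -> R), m (a *: u + v) = a * m u + m v,
      forall u : G -> R, (forall g, 0 <= u g) -> 0 <= m u,
      m (fun=> 1) = 1
    & forall t u k, t \in T -> (forall g, `|u g| <= k) ->
        `|m (fun g => u (t^-1 * g)%g) - m u| <= eps * k].

End ApproxMean.

Section WreathMean.
Variables (R : realType) (L G : groupType).
Local Notation W := (wreath L G).

Definition shiftW (t : G) : W := Wreath (@wreath_one_fin L G) t.

Lemma lamps_conj t (w : W) x :
  lamps (shiftW t * w * (shiftW t)^-1)%g x = lamps w (t^-1 * x)%g.
Proof. by rewrite /= invg1 mulg1 mul1g. Qed.

(** * Lamp configurations on finitely many sites, and the resulting mean *)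

Section Sites.
Variables (S : finType) (s : S -> G) (sI : injective s) (a : L).
Local Notation cube := {ffun S -> bool}.
Implicit Types p q y : cube.

Lemma lampW_fin p :
  finite_set [set x | (if [exists i, (s i == x) && p i] then a else 1%g) != 1%g].
Proof.
apply: (@sub_finite_set _ _ (s @` [set: S])); last exact: finite_image.
move=> x /=; case: existsP => [[i /andP[/eqP <- _]] _|_]; first by exists i.
by rewrite eqxx.
Qed.

Definition lampW p : W := Wreath (lampW_fin p) 1%g.

Definition pow1 (b : bool) : L := if b then a else 1%g.

Lemma lampW_in p i : lamps (lampW p) (s i) = pow1 (p i).
Proof.
rewrite /=; case: existsP => [[j /andP[/eqP/sI -> ->//]]|H].
by rewrite /pow1; case pi : (p i) => //; exfalso; apply: H; exists i; rewrite eqxx.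
Qed.

Lemma lampW_out p x : (forall i, s i <> x) -> lamps (lampW p) x = 1%g.
Proof. by move=> sx; rewrite /=; case: existsP => // -[i /andP[/eqP/sx]]. Qed.

Definition diffW p q : W := (lampW p * (lampW q)^-1)%g.

Lemma lamps_diffW p q x :
  lamps (diffW p q) x = (lamps (lampW p) x * (lamps (lampW q) x)^-1)%g.
Proof. by rewrite /diffW /= invg1 !mul1g. Qed.

Lemma lamps_diffW_in p q i :
  lamps (diffW p q) (s i) = (pow1 (p i) * (pow1 (q i))^-1)%g.
Proof. by rewrite lamps_diffW !lampW_in. Qed.

Lemma lamps_diffW_out p q x : (forall i, s i <> x) -> lamps (diffW p q) x = 1%g.
Proof. by move=> sx; rewrite lamps_diffW !lampW_out// mulgV. Qed.

Hypothesis a1 : a != 1%g.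

Lemma pow1_neq b c : ((pow1 b * (pow1 c)^-1)%g != 1%g) = (b != c).
Proof.
by case: b; case: c; rewrite /pow1 ?mulgV ?invg1 ?mulg1 ?mul1g ?eqxx ?invg_eq1 ?a1.
Qed.

Variables (S0 : set G) (g : W -> R).
Hypothesis gS0 : forall w, g w != 0 -> forall x, lamps w x != 1%g -> S0 x.

Lemma diffW_eq0 p q i : ~ S0 (s i) -> p i != q i -> g (diffW p q) = 0.
Proof.
move=> iS0 pq; apply/eqP; apply: contra_notT iS0 => /gS0; apply.
by rewrite lamps_diffW_in pow1_neq.
Qed.

(** The sites need not be stable under [t^-1], and [sg] is a translation only on [S0]. If one of the
    two elements has its lamps inside [S0], the two elements coincide; otherwise [g] vanishes at
    both. *)
Lemma g_conj_perm t (sg : {perm S}) p q : S0 `<=` range s ->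
  (forall i, S0 (s i) -> s (sg i) = (t^-1 * s i)%g) ->
  g (shiftW t * diffW p q * (shiftW t)^-1)%g
    = g (diffW (cperm sg p) (cperm sg q)).
Proof.
move=> S0s sgt; set w1 := (_ * _)%g; set w2 := diffW _ _.
have [S1|nS1] := pselect (forall x, lamps w1 x != 1%g -> S0 x).
  suff -> : w1 = w2 by [].
  apply: wreath_eq => [y|]; last by rewrite /= !(mulg1, invg1) mulgV.
  have [yS0|yS0] := pselect (S0 y).
    have [j _ jy] := S0s _ yS0; rewrite lamps_conj -jy -sgt ?jy//.
    by rewrite -[in RHS]jy !lamps_diffW_in !ffunE.
  have -> : lamps w1 y = 1%g by apply/eqP; apply: contra_notT yS0 => /S1.
  apply/esym/eqP; apply: contra_notT yS0.
  have [[i <-]|ny] := pselect (exists i, s i = y); last first.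
    by rewrite lamps_diffW_out ?eqxx// => i iy; apply: ny; exists i.
  rewrite lamps_diffW_in pow1_neq !ffunE => pqi.
  (* A lamp of [w2] at [s i] yields a lamp of [w1] at [t * s (sg i)], hence a site of [S0]. As [sg]
     translates that site to [s (sg i)], injectivity identifies it with [s i]. *)
  have /S1 S0t : lamps w1 (t * s (sg i))%g != 1%g.
    by rewrite lamps_conj mulKg lamps_diffW_in pow1_neq.
  have [j _ jt] := S0s _ S0t.
  have := sgt j; rewrite jt mulKg => /(_ S0t) /sI/perm_inj ji.
  by rewrite -ji jt.
have [S2|nS2] := pselect (forall x, lamps w2 x != 1%g -> S0 x).
  exfalso; apply: nS1 => y; rewrite lamps_conj.
  have [[k ky]|ny] := pselect (exists k, s k = t^-1 * y)%g; last first.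
    by rewrite lamps_diffW_out ?eqxx// => i iy; apply: ny; exists i.
  rewrite -ky lamps_diffW_in pow1_neq => pqk.
  have E : sg (sg^-1%g k) = k by rewrite permKV.
  have S0k : S0 (s (sg^-1%g k)).
    by apply: S2; rewrite lamps_diffW_in pow1_neq !ffunE E.
  have := sgt _ S0k; rewrite E ky => /mulgI ->; exact: S0k.
have [->|/gS0//] := eqVneq (g w1) 0.
by have [->|/gS0//] := eqVneq (g w2) 0.
Qed.

Lemma lamp_at_1_fin :
  finite_set [set x : G | (if x == 1%g then a else 1%g) != 1%g].
Proof.
apply: (@sub_finite_set _ _ [set 1%g]); last exact: finite_set1.
by move=> x /=; have [//|_] := eqVneq x 1%g; rewrite eqxx.
Qed.

Definition lamp1 : W := Wreath lamp_at_1_fin 1%g.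

(** Only the site 1 differs, and the quotient there is [a] or its inverse according to [p i0]. This
    is why [g] is controlled at both [lamp1] and its inverse. *)
Lemma diffW_flip i0 p : s i0 = 1%g ->
  diffW p (cxor p (cube1 i0)) = lamp1 \/ diffW p (cxor p (cube1 i0)) = lamp1^-1%g.
Proof.
move=> si0.
have E x : lamps (diffW p (cxor p (cube1 i0))) x =
   if x == 1%g then if p i0 then a else a^-1%g else 1%g.
  have [[i <-]|nx] := pselect (exists i, s i = x); last first.
    rewrite lamps_diffW_out => [|i ix]; last by apply: nx; exists i.
    by case: eqP => // x1; exfalso; apply: nx; exists i0; rewrite x1.
  rewrite lamps_diffW_in !ffunE -si0 (inj_eq sI).
  have [->|ii0] := eqVneq i i0.
    by case: (p i0); rewrite /pow1 ?invg1 ?mulg1 ?mul1g.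
  by rewrite addbF mulgV.
case pi0 : (p i0); [left|right]; apply: wreath_eq => [x|]; rewrite ?E ?pi0//.
- by rewrite /= invg1 mulg1.
- by rewrite /= mul1g; case: (x == 1%g); rewrite ?invg1.
- by rewrite /= !invg1 mulg1.
Qed.

(** At the empty set this is 0, by the convention for division by 0; the mean below sums over
    nonempty [y] only. *)
Definition avg (u : G -> R) y : R :=
  (\sum_(i | y i) u (s i)) / (\sum_(i | y i) 1).

Lemma cube_neq0 y : y != cube0 S -> exists i, y i.
Proof.
move=> y0; apply/existsP; apply: contra_neqT y0 => /existsPn y0.
by apply/ffunP => i; rewrite ffunE; apply/negbTE/y0.
Qed.

Lemma card_gt0 y : y != cube0 S -> 0 < \sum_(i | y i) (1 : R).
Proof.
move=> /cube_neq0 [i yi]; rewrite (bigD1 i)//= ltr_pwDl//.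
by apply: sumr_ge0.
Qed.

Lemma avg_lin b (u v : G -> R) y : avg (b *: u + v) y = b * avg u y + avg v y.
Proof.
rewrite /avg mulrA -mulrDl; congr (_ / _).
by rewrite mulr_sumr -big_split; apply: eq_bigr.
Qed.

Lemma avg_ge0 (u : G -> R) y : (forall x, 0 <= u x) -> 0 <= avg u y.
Proof. by move=> u0; rewrite divr_ge0// sumr_ge0. Qed.

Lemma avg1 y : y != cube0 S -> avg (fun=> 1) y = 1.
Proof. by move=> /card_gt0 y0; rewrite /avg divff// gt_eqF. Qed.

Lemma avg_le (u : G -> R) k y : y != cube0 S -> (forall x, `|u x| <= k) ->
  `|avg u y| <= k.
Proof.
move=> /card_gt0 y0 uk; rewrite normrM normfV (gtr0_norm y0) ler_pdivrMr//.
rewrite mulr_sumr; apply: le_trans (ler_norm_sum _ _ _) _.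
by apply: ler_sum => i _; rewrite mulr1.
Qed.

Lemma avg_perm (u : G -> R) t (sg : {perm S}) y :
  (forall i, y i -> s (sg i) = (t^-1 * s i)%g) ->
  avg (fun x => u (t^-1 * x)%g) y = avg u (cperm sg^-1%g y).
Proof.
move=> yt; rewrite /avg; congr (_ / _).
  rewrite [RHS](reindex_inj (@perm_inj _ sg)).
  by apply: eq_big => [i|i yi]; rewrite ?ffunE ?permK// yt.
rewrite [RHS](reindex_inj (@perm_inj _ sg)).
by apply: eq_bigl => i; rewrite ffunE permK.
Qed.

Hypothesis S0s : S0 `<=` range s.
Variables (i0 : S) (th : R) (T : seq G).
Hypotheses (si0 : s i0 = 1%g) (th0 : 0 < th) (th1 : 10 * th ^+ 2 <= 1).
(** The hypotheses on [g] are at scale [rho ^+ 2], the fourth power of [th]: one square root is lost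
    in passing to almost invariance, another in passing from [F] to the square root of [|F|]. *)
Let rho := th ^+ 2.
Hypotheses (sgT : forall t, t \in T -> exists sg : {perm S},
  forall i, S0 (s i) -> s (sg i) = (t^-1 * s i)%g).
Hypotheses (gschur : schur g (1 + rho ^+ 2)) (g1 : `|g 1%g - 1| <= rho ^+ 2)
  (gx : 1 - rho ^+ 2 <= g lamp1) (gxV : 1 - rho ^+ 2 <= g lamp1^-1%g)
  (gT : forall t, t \in T -> 1 - rho ^+ 2 <= g (shiftW t))
  (gTV : forall t, t \in T -> 1 - rho ^+ 2 <= g (shiftW t)^-1%g).

Local Notation N := (2 ^+ #|S| : R).
Let F := walsh_diag (fun p q => g (diffW p q)).
Let P := spec F.

Lemma rho_gt0 : 0 < rho. Proof. exact: exprn_gt0. Qed.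

Lemma F_l1 : \sum_k `|F k| <= (1 + rho ^+ 2) * N.
Proof. by apply: walsh_diag_l1 => A cA v w; exact: gschur. Qed.

Lemma F_sum : (1 - rho ^+ 2) * N <= \sum_k F k.
Proof.
have -> : \sum_k F k = \sum_k F k * chi R k (cube0 S).
  by apply: eq_bigr => k _; rewrite chi0 mulr1.
rewrite sum_walsh_diag (eq_bigr (fun=> g 1%g)) => [|p _]; last first.
  rewrite (_ : cxor p (cube0 S) = p) ?/diffW ?mulgV//.
  by apply/ffunP => i; rewrite !ffunE addbF.
rewrite sumr_const card_ffun card_bool -[g 1%g *+ _]mulr_natr natrX.
rewrite ler_wpM2r ?exprn_ge0//.
by move: g1; rewrite ler_norml => /andP[]; lra.
Qed.

Lemma F_chi : (1 - rho ^+ 2) * N <= \sum_k F k * chi R k (cube1 i0).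
Proof.
have -> : N = #|{ffun S -> bool}|%:R by rewrite card_ffun card_bool natrX.
rewrite sum_walsh_diag mulr_natr -sumr_const.
by apply: ler_sum => p _; case: (diffW_flip p si0) => ->.
Qed.

(** By [g_conj_perm], the difference is the Walsh diagonal of the kernel of
    [x |-> g (t x t^-1) - g x], whose Schur norm is at most [16 * rho]. *)
Lemma F_perm t : t \in T -> exists sg : {perm S},
  (forall i, S0 (s i) -> s (sg i) = (t^-1 * s i)%g) /\
  \sum_k `|F (cperm sg k) - F k| <= 16 * rho * N.
Proof.
move=> tT; have [sg sgP] := sgT tT; exists sg; split=> //.
under eq_bigr do rewrite /F -walsh_diag_perm -walsh_diagB.
apply: walsh_diag_l1 => A cA v w.
have rho1 : rho <= 1 by have := th1; have := rho_gt0; rewrite -/rho; lra.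
have g1' : 1 - rho ^+ 2 <= g 1%g.
  by move: g1; rewrite ler_norml => /andP[]; lra.
have := schur_near_conj_invariant rho_gt0 rho1 gschur g1' (gT tT) (gTV tT).
move=> /(_ _ lampW lampW A cA v w); apply: le_trans.
rewrite /bilin ler_sum// => p _; rewrite ler_sum// => q _.
by rewrite -(g_conj_perm _ _ S0s sgP).
Qed.

(** The kernel vanishes when [p] and [q] differ at a site outside [S0], so [F] does not depend on
    that bit. Thus [P] lives on subsets of [S0], where [sg] acts by translation. *)
Lemma P_supp y i : y i -> ~ S0 (s i) -> P y = 0.
Proof.
move=> yi iS0; apply: spec_eq0 yi => k; apply: walsh_diag_flip => p q.
exact: diffW_eq0.
Qed.

Let Z := \sum_(y | y != cube0 S) P y.
Let m (u : G -> R) := Z^-1 * \sum_(y | y != cube0 S) P y * avg u y.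

Lemma Z_ge : 1 / 4 <= Z.
Proof.
by apply: spec_mass F_l1 F_sum F_chi => //; exact: rho_gt0.
Qed.

(** The mean draws a nonempty set of sites with law [P / Z] and averages over it. Translation by [t]
    permutes these sets, so the error is at most [Z^-1 * (12 * th) * k], where [Z^-1 <= 4]. *)
Lemma wreath_mean : exists m', approx_mean T (48 * th) m'.
Proof.
have Z4 := Z_ge; have Z0 : 0 < Z by lra.
exists m; split.
- move=> b u v; rewrite /m mulrCA -mulrDr; congr (_ * _).
  rewrite mulr_sumr -big_split; apply: eq_bigr => y _ /=.
  by rewrite avg_lin; ring.
- move=> u u0; rewrite mulr_ge0 ?invr_ge0 ?(ltW Z0)// sumr_ge0// => y _.
  by rewrite mulr_ge0 ?spec_ge0 ?avg_ge0.
- rewrite /m (eq_bigr P) => [|y y0]; first by rewrite mulVf ?gt_eqF.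
  by rewrite avg1// mulr1.
move=> t u k tT uk; have k0 : 0 <= k by apply: le_trans (uk 1%g).
have [sg [sgP sgF]] := F_perm tT.
have c0 y (s' : {perm S}) : (cperm s' y != cube0 S) = (y != cube0 S).
  have E : cperm s' (cube0 S) = cube0 S by apply/ffunP => i; rewrite !ffunE.
  by rewrite -{1}E (inj_eq (@cperm_inj _ _)).
have -> : m (fun x => u (t^-1 * x)%g) =
    Z^-1 * \sum_(y | y != cube0 S) P (cperm sg y) * avg u y.
  congr (_ * _); rewrite [RHS](reindex_inj (@cperm_inj _ sg^-1%g)).
  apply: eq_big => [y|y y0]; first by rewrite c0.
  have -> : cperm sg (cperm sg^-1%g y) = y by have := cpermK sg^-1%g y; rewrite invgK.
  (* Where [P y] is nonzero, [y] consists of sites in [S0], so [avg_perm] applies. *)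
  have [->|P0] := eqVneq (P y) 0; first by rewrite !mul0r.
  congr (_ * _); apply: avg_perm => i yi; apply: sgP.
  by apply/not_notP => /(P_supp yi) /eqP; rewrite (negbTE P0).
rewrite -mulrBr -sumrB normrM ger0_norm ?invr_ge0 ?(ltW Z0)//.
have Z4' : Z^-1 <= 4.
  by rewrite -[4]invrK lef_pV2 ?posrE ?invr_gt0//; lra.
have F2 : \sum_k `|F k| <= 2 * N.
  apply: le_trans F_l1 _; rewrite ler_wpM2r ?exprn_ge0//.
  have : rho ^+ 2 <= 1.
    by rewrite expr_le1 ?(ltW rho_gt0)//; have := th1; have := rho_gt0; rewrite -/rho; lra.
  lra.
have H := spec_close th0 F2 sgF.
have -> : 48 * th * k = 4 * (12 * th * k) by ring.
apply: ler_pM => //; first by rewrite invr_ge0 ltW.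
apply: (@le_trans _ _ (\sum_y `|P (cperm sg y) - P y| * k)).
  apply: le_trans (ler_norm_sum _ _ _) _.
  rewrite [leRHS](bigID (fun y => y != cube0 S)) /=.
  apply: ler_wpDr; first by apply: sumr_ge0 => y _; rewrite mulr_ge0.
  apply: ler_sum => y y0; rewrite -mulrBl normrM ler_wpM2l//.
  exact: avg_le.
by rewrite -mulr_suml ler_wpM2r.
Qed.

End Sites.
End WreathMean.

(** * Amenability *)

Section MeanLimit.
Variables (R : realType) (G : groupType).
Local Notation X := ((G -> R) -> R).

Lemma approx_mean_le (T T' : seq G) (e e' : R) (m : X) : e <= e' ->
  {subset T' <= T} -> approx_mean T e m -> approx_mean T' e' m.
Proof.
move=> ee TT [m1 m2 m3 m4]; split=> // t u k /TT tT uk.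
apply: le_trans (m4 t u k tT uk) _; rewrite ler_wpM2r//.
by apply: le_trans (uk 1%g).
Qed.

Lemma approx_mean_bound (T : seq G) (e : R) (m : X) u k : approx_mean T e m ->
  (forall g, `|u g| <= k) -> -k <= m u <= k.
Proof.
move=> [ml m0 m1 _] uk.
have mB (v w : G -> R) (b : R) : m (b *: v + w) = b * m v + m w by exact: ml.
have m00 : m 0 = 0 by have := mB 0 0 1; rewrite scaler0 addr0 mul1r; lra.
have mZ b : m (fun=> b) = b.
  have := mB (fun=> 1) 0 b; rewrite m00 m1 !addr0 mulr1 => E.
  by rewrite -[RHS]E; congr m; apply/funext => g; exact/esym/mulr1.
have k1 : 0 <= m (1 *: u + (fun=> k)).
  apply: m0 => g; suff : 0 <= 1 * u g + k by [].
  rewrite mul1r.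
  by have := uk g; rewrite ler_norml => /andP[]; lra.
have k2 : 0 <= m (-1 *: u + (fun=> k)).
  apply: m0 => g; suff : 0 <= -1 * u g + k by [].
  rewrite mulN1r.
  by have := uk g; rewrite ler_norml => /andP[]; lra.
by move: k1 k2; rewrite !mB !mZ; lra.
Qed.

(** The sets [B (T, n)] of approximate means generate a filter, the union of two lists and the
    larger index giving a common refinement. The invariant mean is the pointwise limit along an
    ultrafilter above it. *)
Lemma amenable_of_approx_means :
  (forall (T : seq G) (e : R), 0 < e -> exists m, approx_mean T e m) ->
  amenable R G.
Proof.
move=> Hm.
pose B (i : seq G * nat) : set X := [set m | approx_mean i.1 (i.2.+1%:R^-1) m].
pose FF := filter_from [set: seq G * nat] B.
have FFF : ProperFilter FF.
  apply: filter_from_proper => [|[T n] _]; last first.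
    by have [m mP] := Hm T (n.+1%:R^-1) (ltac:(by rewrite invr_gt0 ltr0n)); exists m.
  apply: filter_fromT_filter; first by exists ([::], 0%N).
  move=> [T n] [T' n']; exists (T ++ T', maxn n n') => m /= mP; split.
    apply: approx_mean_le mP => /=; last by move=> t tT; rewrite mem_cat tT.
    by rewrite lef_pV2 ?posrE// ler_nat ltnS leq_maxl.
  apply: approx_mean_le mP => /=; last by move=> t tT; rewrite mem_cat tT orbT.
  by rewrite lef_pV2 ?posrE// ler_nat ltnS leq_maxr.
have [U [UU FU]] := ultraFilterLemma FFF.
have UB i : U (B i) by apply: FU; exists i.
pose M (u : G -> R) : R := lim ((fun m : X => m u) @ U).
have cM u : bounded_fct u -> (fun m : X => m u) @ U --> M u.
  move=> [k uk].
  (* The values on [u] stay in a compact interval, so the image ultrafilter converges. *)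
  have Uk : ((fun m : X => m u) @ U) [set` `[- k, k]].
    suff : U [set m : X | m u \in `[- k, k]] by [].
    apply: (filterS _ (UB ([::], 0%N))) => m mP.
    by rewrite /= in_itv /=; exact: approx_mean_bound mP uk.
  have [p [_ clp]] := @segment_compact R (- k) k _ _ Uk.
  apply/cvg_ex; exists p => A pA.
  have [//|UnA] := in_ultra_setVsetC ((fun m : X => m u) @^-1` A) UU.
  by have [x [+ /= xA]] := clp (~` A) A UnA pA.
have bound_shift s u : bounded_fct u -> bounded_fct (fun g => u (s^-1 * g)%g).
  by move=> [k uk]; exists k => g.
exists M; split.
- move=> a u v bu bv.
  have buv : bounded_fct (a *: u + v).
    move: bu bv => [k uk] [l vl]; exists (`|a| * k + l) => g.
    suff : `|a * u g + v g| <= `|a| * k + l by [].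
    apply: le_trans (ler_normD _ _) _.
    by rewrite normrM lerD// ler_wpM2l.
  apply/cvg_lim => //.
  apply: cvg_trans (cvgD (cvgM (cvg_cst a) (cM _ bu)) (cM _ bv)).
  by apply: near_eq_cvg; apply: (filterS _ (UB ([::], 0%N))) => m [ml _ _ _].
- move=> u bu u0; apply: (closed_cvg _ (@closed_ge R 0) _ _ (cM _ bu)) => //.
  by apply: (filterS _ (UB ([::], 0%N))) => m [_ m0 _ _]; exact: m0.
- apply/cvg_lim => //; apply: cvg_trans (@cvg_cst _ (1 : R) _ U _).
  by apply: near_eq_cvg; apply: (filterS _ (UB ([::], 0%N))) => m [_ _ m1 _].
move=> s u bu; have [k uk] := bu.
have cD : (fun m : X => m (fun g => u (s^-1 * g)%g) - m u) @ U -->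
    M (fun g => u (s^-1 * g)%g) - M u.
  by apply: cvgB; apply: cM => //; exact: bound_shift.
apply/eqP; rewrite -subr_eq0; apply/eqP.
have k0 : 0 <= k by apply: le_trans (uk 1%g).
apply: (cvg_unique _ cD) => //; apply/cvgrPdist_lt => e e0.
have [n nP] : exists n, n.+1%:R^-1 * k < e.
  exists (Num.truncn (k / e)); rewrite mulrC ltr_pdivrMr//.
  by rewrite -ltr_pdivrMl// mulrC; exact: truncnS_gt.
apply: (filterS _ (UB ([:: s], n))) => m [_ _ _ /(_ s u k)].
rewrite mem_head sub0r normrN => /(_ isT uk) H.
exact: le_lt_trans H nP.
Qed.

End MeanLimit.

(** * Choice of the finite data for the wreath product *)

Section MainGroup.
Variables (R : realType) (L G : groupType).

(** The common consequence of the two approximation properties from which amenability is deduced. *)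
Definition schur_approximable (K : groupType) : Prop :=
  forall (E : seq K) (e : R), 0 < e -> exists g : K -> R,
    [/\ finite_set [set x | g x != 0], schur g (1 + e)
      & forall x, x \in E -> `|g x - 1| <= e].

Lemma amenable_of_schur_approximable (a : L) : a != 1%g ->
  schur_approximable (wreath L G) -> amenable R G.
Proof.
move=> a1 Happ; apply: amenable_of_approx_means => T e e0.
pose th : R := Num.min (e / 48) (1 / 10).
have th0 : 0 < th by rewrite lt_min !divr_gt0.
have the : 48 * th <= e.
  have : th <= e / 48 by rewrite ge_min lexx.
  lra.
have th1 : 10 * th ^+ 2 <= 1.
  have H : th <= 1 / 10 by rewrite ge_min lexx orbT.
  have H2 : th * th <= 1 / 10 * 1 by apply: ler_pM; lra.
  by rewrite expr2; lra.
pose E := [:: 1%g; lamp1 G a; (lamp1 G a)^-1%g] ++ map (@shiftW L G) T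
          ++ map (fun t => (@shiftW L G t)^-1%g) T.
have [g [gfin gs gE]] := Happ E ((th ^+ 2) ^+ 2) (ltac:(by rewrite !exprn_gt0)).
pose S0 : set G := \bigcup_(w in [set w | g w != 0]) [set x | lamps w x != 1%g].
have S0fin : finite_set S0.
  by apply: bigcup_finite => // w _; exact: lamps_fin.
(* The sites: the lamps seen by [g], the identity for [lamp1], and the translates of [S0] by
   inverses from [T], so that [t^-1] maps [S0] into [S1]. *)
pose S1 : set G := S0 `|` ([set 1%g] `|`
  \bigcup_(t in [set` T]) ((fun x => (t^-1 * x)%g) @` S0)).
have S1fin : finite_set S1.
  rewrite !finite_setU; split=> //; split; first exact: finite_set1.
  by apply: bigcup_finite => // t _; exact: finite_image.
have [S1f S1E] := finite_fsetP.1 S1fin.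
pose s : S1f -> G := val.
have sI : injective s by exact: val_inj.
have S1s x : S1 x -> exists i, s i = x.
  by rewrite S1E => xS; exists [` xS ]%fset.
have [i0 si0] : exists i0, s i0 = 1%g by apply: S1s; right; left.
have S0s : S0 `<=` range s.
  by move=> x xS; have [i ix] := S1s x (or_introl xS); exists i.
have gS0 w : g w != 0 -> forall x, lamps w x != 1%g -> S0 x.
  by move=> gw x wx; exists w.
have close x : x \in E -> 1 - (th ^+ 2) ^+ 2 <= g x.
  by move/gE; rewrite ler_norml => /andP[]; lra.
have [|||||||m mP] := wreath_mean sI a1 gS0 S0s si0 th0 th1 (T := T).
- move=> t tT.
  (* Outside [S0] any value serves; the function is injective on the sites in [S0], and
     [perm_extension] completes it from there. *)
  have St i : exists j, S0 (s i) -> s j = (t^-1 * s i)%g.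
    have [iS0|] := pselect (S0 (s i)); last by exists i.
    have [j jE] : exists j, s j = (t^-1 * s i)%g.
      by apply: S1s; right; right; exists t => //; exists (s i).
    by exists j.
  have [f fP] := choice St.
  have [|sg sgP] := @perm_extension _ [set i | `[< S0 (s i) >]]%SET f.
    move=> i j; rewrite !inE => iS jS fij; apply: sI.
    by apply: (@mulgI _ t^-1%g); rewrite -(fP _ iS) -(fP _ jS) fij.
  exists sg => i iS; rewrite sgP ?fP// inE; exact/asboolP.
- exact: gs.
- by apply: gE; rewrite inE eqxx.
- by apply: close; rewrite !inE eqxx ?orbT.
- by apply: close; rewrite !inE eqxx ?orbT.
- move=> t tT; apply: close; rewrite !mem_cat; apply/orP; right.
  by apply/orP; left; exact: map_f.
- move=> t tT; apply: close; rewrite !mem_cat; apply/orP; right.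
  by apply/orP; right; exact: (map_f (fun t => (@shiftW L G t)^-1%g)).
by exists m; exact: approx_mean_le mP.
Qed.

End MainGroup.

(** * From completely bounded maps to Schur multipliers *)

Section Ell2Theory.
Variables (R : realType) (I : choiceType).
Local Notation C := R[i].
Local Notation H := (ell2 R I).
Implicit Types x y : H.

Lemma normc_sqr (z : C) : normc z ^+ 2 = complex.Re z ^+ 2 + complex.Im z ^+ 2.
Proof. by case: z => a b; rewrite /normc sqr_sqrtr// addr_ge0// sqr_ge0. Qed.

Lemma normc_ge0 (z : C) : 0 <= normc z.
Proof. by case: z => a b; exact: sqrtr_ge0. Qed.

Lemma normc_real (a : R) : normc (a%:C)%C = `|a|.
Proof. by rewrite /normc /= expr0n addr0 sqrtr_sqr. Qed.

Lemma Re_le_normc (z : C) : `|complex.Re z| <= normc z.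
Proof.
case: z => a b; rewrite /normc /= -sqrtr_sqr.
by rewrite ler_sqrt ?addr_ge0 ?sqr_ge0// lerDl sqr_ge0.
Qed.

Lemma Im_le_normc (z : C) : `|complex.Im z| <= normc z.
Proof.
case: z => a b; rewrite /normc /= -sqrtr_sqr.
by rewrite ler_sqrt ?addr_ge0 ?sqr_ge0// lerDr sqr_ge0.
Qed.

Lemma sqsum_ge0 (u : I -> C) : (0 <= sqsum u)%E.
Proof. by apply: esum_ge0 => i _; rewrite lee_fin sqr_ge0. Qed.

Lemma normsqE x : (normsq x)%:E = sqsum x.
Proof.
rewrite fineK// ge0_fin_numE ?sqsum_ge0//.
by have /asboolP := ell2_subproof x.
Qed.

Lemma normsq_ge0 x : 0 <= normsq x.
Proof. by rewrite -lee_fin normsqE sqsum_ge0. Qed.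

Lemma sum_le_normsq x (A : {fset I}) : \sum_(i <- A) normc (x i) ^+ 2 <= normsq x.
Proof.
rewrite -lee_fin normsqE -sumEFin; apply: esum_ge; exists [set` A].
  by split=> //; exact: finite_fset.
by rewrite -fsbig_seq ?fset_uniq.
Qed.

Lemma normc_le_normsq x i : normc (x i) ^+ 2 <= normsq x.
Proof. by have := sum_le_normsq x [fset i]%fset; rewrite big_seq_fset1. Qed.

Lemma sqsum_le (u : I -> C) (M : R) :
  (forall A : {fset I}, \sum_(i <- A) normc (u i) ^+ 2 <= M) ->
  (sqsum u <= M%:E)%E.
Proof.
move=> uM; apply: ge_ereal_sup => _ [A [finA _] <-].
have [B ->] := finite_fsetP.1 finA.
by rewrite -fsbig_seq ?fset_uniq// sumEFin lee_fin uM.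
Qed.

Lemma normsq_le x (M : R) :
  (forall A : {fset I}, \sum_(i <- A) normc (x i) ^+ 2 <= M) -> normsq x <= M.
Proof. by move=> /sqsum_le; rewrite -normsqE lee_fin. Qed.

Lemma normsq_le_pointwise (J K : finType) (y : J -> H) (u : K -> H) :
  (forall i, \sum_j normc (y j i) ^+ 2 <= \sum_k normc (u k i) ^+ 2) ->
  \sum_j normsq (y j) <= \sum_k normsq (u k).
Proof.
move=> yu; rewrite -lee_fin -!sumEFin.
under eq_bigr do rewrite normsqE.
under [leRHS]eq_bigr do rewrite normsqE.
rewrite /sqsum -!esum_sum; do ?by move=> *; rewrite lee_fin sqr_ge0.
by apply: le_esum => i _; rewrite !sumEFin lee_fin.
Qed.

Lemma normsqZ_le (a : C) x : normsq (a *: x) <= normc a ^+ 2 * normsq x.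
Proof. by rewrite -lee_fin EFinM !normsqE sqsumZ_le. Qed.

Lemma ell2_sumE (J : finType) (y : J -> H) i : (\sum_j y j) i = \sum_j y j i.
Proof. by elim/big_ind2 : _ => // a b c d <- <-. Qed.

Lemma mx_opnorm_normsq_le n (T : 'M[H -> H]_n) (c : R) (v : 'I_n -> H) :
  (mx_opnorm T <= c%:E)%E -> tuple_normsq v <= 1 ->
  0 <= c /\ \sum_i normsq (\sum_j T i j (v j)) <= c ^+ 2.
Proof.
move=> Tc v1.
have : Num.sqrt (\sum_i normsq (\sum_j T i j (v j))) <= c.
  by rewrite -lee_fin; apply: le_trans Tc; apply: ereal_sup_ubound; exists v.
move=> sc; have c0 : 0 <= c by apply: le_trans sc; exact: sqrtr_ge0.
split=> //; rewrite -[leLHS]sqr_sqrtr ?ler_pXn2r ?nnegrE ?sqrtr_ge0//.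
by apply: sumr_ge0 => i _; exact: normsq_ge0.
Qed.

End Ell2Theory.

Section CbSchur.
Variables (R : realType) (G : groupType).
Local Notation C := R[i].
Local Notation H := (ell2 R G).

Lemma contraction_sqn (I : finType) (A : I -> I -> R) (v : I -> R) :
  contraction A -> sqn (fun i => \sum_j A i j * v j) <= sqn v.
Proof.
move=> cA; have := cA v (fun i => \sum_j A i j * v j).
suff -> : bilin A v (fun i => \sum_j A i j * v j) =
   sqn (fun i => \sum_j A i j * v j) by lra.
by rewrite /bilin /sqn; apply: eq_bigr => i _; rewrite -mulr_suml expr2.
Qed.

Lemma contraction_complex (I : finType) (A : I -> I -> R) (z : I -> C) :
  contraction A ->
  \sum_i normc (\sum_j (A i j)%:C%C * z j) ^+ 2 <= \sum_j normc (z j) ^+ 2.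
Proof.
move=> cA.
have E : forall i, normc (\sum_j (A i j)%:C%C * z j) ^+ 2 =
   (\sum_j A i j * complex.Re (z j)) ^+ 2 + (\sum_j A i j * complex.Im (z j)) ^+ 2.
  move=> i; rewrite normc_sqr !raddf_sum /=; congr (_ ^+ 2 + _ ^+ 2);
    apply: eq_bigr => j _; case: (z j) => a b /=; rewrite mul0r ?subr0 ?addr0 //.
under eq_bigr do rewrite E.
under [leRHS]eq_bigr do rewrite normc_sqr.
by rewrite !big_split lerD//; exact: contraction_sqn.
Qed.

Definition dirac (q : G) : H := ltrans q (delta1 R G).

Lemma diracE q h : dirac q h = (h == q)%:R.
Proof. by rewrite /= -(inj_eq (@mulgI _ q)) mulVKg mulg1. Qed.

Lemma normsq_ltrans g (x : H) : normsq (ltrans g x) = normsq x.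
Proof.
congr fine; rewrite /sqsum -(@reindex_esum _ _ _ setT setT (fun h => (g^-1 * h)%g)
  (fun h => ((normc (x h)) ^+ 2)%:E))//.
split=> // [u v _ _|h _]; first exact: mulgI.
by exists (g * h)%g => //; rewrite mulKg.
Qed.

Lemma normsq_dirac q : normsq (dirac q) <= 1.
Proof.
apply: normsq_le => A; under eq_bigr do rewrite diracE.
have [qA|qA] := boolP (q \in A).
  rewrite (big_fsetD1 q)//= eqxx normc1 expr1n big1_seq ?addr0// => i.
  by rewrite !inE => /andP[_ /andP[/negbTE ->]]; rewrite normc0 expr0n.
rewrite big1_seq// => i /andP[_ iA]; case: eqP => [iq|_].
  by rewrite iq (negbTE qA) in iA.
by rewrite normc0 expr0n.
Qed.

(** The matrix with entries [A i j] times translation by [p i * (q j)^-1] is [A] conjugated by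
    diagonal unitaries, hence a contraction. Its image under the amplified [phi] is applied to
    multiples of the [dirac (q j)] and read at the coordinates [p i], which yields the Schur product
    of [A] with the kernel of [f]. *)
Lemma schur_of_cb_norm (E : Type) (rep : E -> H -> H) (D : set E) (phi : E -> E)
    (e : R -> G -> E) (f : G -> C) (c : R) :
  0 < c -> (cb_norm rep D phi <= c%:E)%E ->
  (forall a g, D (e a g)) ->
  (forall a g x, rep (e a g) x = a%:C%C *: ltrans g x) ->
  (forall a b p q, rep (phi (e a (p * q^-1)%g)) (b%:C%C *: dirac q) p
     = (a * b)%:C%C * f (p * q^-1)%g) ->
  schur (fun g => complex.Re (f g)) c.
Proof.
move=> c0 cb De repe repphi; apply: schur_of_sqn => // I p q A cA v.
pose P (i : 'I_#|I|) := p (enum_val i); pose Q (i : 'I_#|I|) := q (enum_val i).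
pose X := \matrix_(i < #|I|, j < #|I|)
  e (A (enum_val i) (enum_val j)) (P i * (Q j)^-1)%g.
have X1 : (mx_opnorm (map_mx rep X) <= 1)%E.
  apply: ge_ereal_sup => _ [y y1 <-]; rewrite lee_fin -[leRHS]sqrtr1.
  rewrite ler_sqrt//; apply: le_trans y1; rewrite /tuple_normsq.
  (* Undoing the translations by [P i] and [Q j] leaves [A] acting separately on the coordinates at
     each [h]. *)
  under eq_bigr => i _ do rewrite -(normsq_ltrans (P i)^-1%g).
  under [leRHS]eq_bigr => i _ do rewrite -(normsq_ltrans (Q i)^-1%g).
  apply: normsq_le_pointwise => h.
  pose z i := ltrans (Q (enum_rank i))^-1%g (y (enum_rank i)) h.
  have := contraction_complex z cA.
  rewrite (reindex _ (onW_bij _ (@enum_val_bij I))) /=.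
  rewrite [leRHS](reindex _ (onW_bij _ (@enum_val_bij I))) /=.
  rewrite [X in X <= _](_ : _ = \sum_(i < #|I|)
     normc (ltrans (P i)^-1%g (\sum_j map_mx rep X i j (y j)) h) ^+ 2).
    by move/le_trans; apply; apply: ler_sum => j _; rewrite /z enum_valK.
  apply: eq_bigr => i _; congr (normc _ ^+ 2).
  rewrite [RHS]ell2_sumE (reindex _ (onW_bij _ (@enum_val_bij I))) /=.
  apply: eq_bigr => j _; rewrite !mxE repe /z enum_valK /=.
  rewrite !invgK invgM invgK; congr (_ * y j _).
  by rewrite -mulgA mulKg.
have X2 : (mx_opnorm (map_mx (rep \o phi) X) <= c%:E)%E.
  apply: le_trans cb; apply: ereal_sup_ubound.
  by exists (existT (fun n => 'M[E]_n) #|I| X) => //; split=> // i j; rewrite mxE.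
pose gA i j := A i j * complex.Re (f (p i * (q j)^-1)%g).
have key (b : I -> R) : sqn b <= 1 -> sqn (fun i => \sum_j gA i j * b j) <= c ^+ 2.
  move=> b1; pose y (j : 'I_#|I|) := (b (enum_val j))%:C%C *: dirac (Q j).
  have y1 : tuple_normsq y <= 1.
    apply: le_trans b1; rewrite /sqn (reindex _ (onW_bij _ (@enum_val_bij I))) /=.
    apply: ler_sum => j _; apply: le_trans (normsqZ_le _ _) _.
    rewrite normc_real real_normK ?num_real//.
    by rewrite -[leRHS]mulr1 ler_wpM2l ?sqr_ge0 ?normsq_dirac.
  have [_] := mx_opnorm_normsq_le X2 y1; apply: le_trans.
  rewrite /sqn (reindex _ (onW_bij _ (@enum_val_bij I))) /=.
  (* Only coordinate [P i] of row [i] is kept, and then only its real part. *)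
  apply: ler_sum => i _; apply: le_trans (normc_le_normsq _ (P i)).
  rewrite normc_sqr ell2_sumE; apply: ler_wpDr; first exact: sqr_ge0.
  rewrite raddf_sum /= (reindex _ (onW_bij _ (@enum_val_bij I))) /=.
  rewrite le_eqVlt; apply/orP; left; apply/eqP; congr (_ ^+ 2).
  apply: eq_bigr => j _; rewrite !mxE /= repphi /gA.
  rewrite -/(P i) -/(Q j); case: (f _) => f1 f2 /=; ring.
set x := fun i => _.
have [v0|v0] := eqVneq (sqn v) 0.
  have vi j : v j = 0.
    apply/eqP; rewrite -sqrf_eq0; apply/eqP.
    by move/psumr_eq0P: v0 => /(_ (fun i _ => sqr_ge0 (v i))); exact.
  rewrite v0 mulr0 /sqn big1// => i _; rewrite /x big1 ?expr0n// => j _.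
  by rewrite vi mulr0.
have vp : 0 < sqn v by rewrite lt0r v0 sqn_ge0.
pose r := Num.sqrt (sqn v).
have r2 : r ^+ 2 = sqn v by rewrite sqr_sqrtr// ltW.
have := key (fun j => r^-1 * v j).
rewrite sqnZ exprVn r2 mulVf// => /(_ (lexx _)).
have -> : (fun i => \sum_j gA i j * (r^-1 * v j)) = (fun i => r^-1 * x i).
  by apply/funext => i; rewrite mulr_sumr; apply: eq_bigr => j _; rewrite mulrCA.
by rewrite sqnZ exprVn r2 mulrC ler_pdivrMr.
Qed.

End CbSchur.

(** * Group approximation nets *)

Section Nets.
Variables (R : realType) (N : Type) (le : N -> N -> Prop).
Hypothesis dle : directed le.

Lemma net_limsup_le (u : N -> \bar R) (c d : R) :
  (net_limsup le u <= c%:E)%E -> c < d ->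
  exists n, forall p, le n p -> (u p <= d%:E)%E.
Proof.
move=> uc cd; have : (net_limsup le u < d%:E)%E by apply: le_lt_trans uc _.
move=> /ereal_inf_lt[_ [n _ <-]] nd; exists n => p np.
by apply: le_trans (ltW nd); apply: ereal_sup_ubound; exists p.
Qed.

Lemma directed_all (K : eqType) (E : seq K) (Q : K -> N -> Prop) (n0 : N) :
  (forall x, exists n, forall p, le n p -> Q x p) ->
  exists p, le n0 p /\ forall x, x \in E -> Q x p.
Proof.
have [_ lexx_ letr ledir] := dle; move=> ev.
suff [n [n0n nP]] : exists n, le n0 n /\
    forall p, le n p -> forall x, x \in E -> Q x p.
  by exists n; split=> // x; apply: nP.
elim: E => [|x E [n [n0n nP]]]; first by exists n0; split.
have [n' n'P] := ev x; have [k [nk n'k]] := ledir n n'.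
exists k; split=> [|p kp y]; first exact: letr nk.
rewrite inE => /predU1P[->|yE]; first by apply: n'P; apply: letr kp.
by apply: nP yE; apply: letr kp.
Qed.

End Nets.

Section GroupCase.
Variables (R : realType) (G : groupType).
Local Notation C := R[i].

Lemma lconv_single (b : G -> C) g (x : ell2 R G) :
  (forall h, h != g -> b h = 0) -> lconv b x = b g *: ltrans g x.
Proof.
move=> b0; rewrite /lconv -(fsbig_widen [set g]) ?fsbig_set1//.
by move=> h [_ /= /eqP hg]; rewrite b0// scale0r.
Qed.

Lemma Re_dist_le (z : C) (e : R) : normc (1 - z) <= e -> `|complex.Re z - 1| <= e.
Proof.
by apply: le_trans; rewrite distrC; have := Re_le_normc (1 - z); rewrite raddfB.
Qed.

Lemma schur_multiplier (f : G -> C) (c : R) : 0 < c ->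
  (multiplier_cb_norm f <= c%:E)%E -> schur (fun g => complex.Re (f g)) c.
Proof.
move=> c0 /(schur_of_cb_norm c0) H.
apply: (H (fun a g h => if h == g then a%:C%C else 0)).
- move=> a g; apply: (@sub_finite_set _ _ [set g]) => [h /=|].
    by have [//|_] := eqVneq h g; rewrite eqxx.
  exact: finite_set1.
- move=> a g x; rewrite (lconv_single (g := g)) ?eqxx// => h /negbTE hg.
  by rewrite hg.
move=> a b p q; rewrite (lconv_single (g := (p * q^-1)%g)); last first.
  by move=> h /negbTE hg; rewrite /multiplier hg mulr0.
rewrite /multiplier eqxx.
transitivity (f (p * q^-1)%g * a%:C%C * (b%:C%C * dirac R q ((p * q^-1)^-1 * p)%g)).
  by [].
by rewrite diracE invgM invgK -mulgA mulVg mulg1 eqxx mulr1 rmorphM /=; ring.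
Qed.

Lemma schur_approximable_of_group_Lambda_cb :
  ~ (1 < group_Lambda_cb R G)%E -> schur_approximable R G.
Proof.
move=> /negP; rewrite -leNgt => L1 E e e0.
have : (group_Lambda_cb R G < (1 + e)%:E)%E.
  by apply: le_lt_trans L1 _; rewrite lte_fin ltrDl.
move=> /ereal_inf_lt[_ [c [c1 [N [le [f [dle ff fc f1]]]]] <-]].
rewrite lte_fin => ce.
have [n0 n0P] := net_limsup_le fc ce.
have ev x : exists n, forall p, le n p -> `|complex.Re (f p x) - 1| <= e.
  have := f1 x => /(_ _ (nbhsx_ballx (1 : C^o) e%:C%C _)) [|n _ nP].
    by rewrite ltcR.
  exists n => p /nP; rewrite -ball_normE /= => H; apply: Re_dist_le.
  by have : ((normc (1 - f p x))%:C%C < e%:C%C) := H; rewrite ltcR => /ltW.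
have [p [n0p pE]] := directed_all dle E n0 ev.
exists (fun g => complex.Re (f p g)); split=> //.
- apply: sub_finite_set (ff p) => g /=; apply: contra_neq => ->.
  by [].
- by apply: schur_multiplier (n0P _ n0p); rewrite addr_gt0.
Qed.

End GroupCase.

(** * Inner products and adjoints *)

Section InnerProduct.
Variables (R : realType) (I : choiceType).
Local Notation C := R[i].
Local Notation H := (ell2 R I).
Implicit Types x y : H.

(** Unconditional convergence with a real tolerance; [sums_lim] links it to the limit in [inner]. *)
Definition sums (z : I -> C) (l : C) : Prop :=
  forall e : R, 0 < e -> exists A0 : {fset I}, forall A : {fset I},
    (A0 `<=` A)%fset -> normc (l - \sum_(i <- A) z i) <= e.

Lemma sums_lim z l : sums z l ->
  lim ((fun A : {fset I} => (\sum_(i <- A) z i : C^o)) @ @summability.totally I) = l.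
Proof.
move=> zl; have FF := @summability.totally_filter I.
apply/cvg_lim; first exact: (@norm_hausdorff _ (C^o)).
(* In the order on complex numbers, [0 < e] forces [e] to be real. *)
apply/(@cvgrPdist_le _ (C^o)) => e e0; have [er eE] : exists r : R, e = r%:C%C.
  by exists (complex.Re e); case: e e0 => a b; rewrite ltcE /= => /andP[/eqP -> _].
have [|A0 A0P] := zl er; first by move: e0; rewrite eE ltcR.
exists A0 => // A /A0P; rewrite eE => H.
by have : ((normc (l - \sum_(i <- A) z i))%:C%C <= er%:C%C) by rewrite lecR.
Qed.

Lemma sums_ext z z' l : z =1 z' -> sums z l -> sums z' l.
Proof. by move=> /funext ->. Qed.

Lemma sums_lin a z l z' l' : sums z l -> sums z' l' ->
  sums (fun i => a * z i + z' i) (a * l + l').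
Proof.
move=> zl zl' e e0.
have a0 : 0 < normc a + 1 by rewrite ltr_wpDl// normc_ge0.
have [|A AP] := zl (e / 2 / (normc a + 1)); first by rewrite !divr_gt0.
have [|A' A'P] := zl' (e / 2); first by rewrite divr_gt0.
exists (A `|` A')%fset => B; rewrite fsubUset => /andP[/AP AB /A'P A'B].
have -> : a * l + l' - \sum_(i <- B) (a * z i + z' i) =
    a * (l - \sum_(i <- B) z i) + (l' - \sum_(i <- B) z' i).
  by rewrite big_split /= -mulr_sumr; ring.
apply: le_trans (le_normcD _ _) _; rewrite normcM.
have : normc a * normc (l - \sum_(i <- B) z i) <=
       (normc a + 1) * (e / 2 / (normc a + 1)).
  by apply: ler_pM; rewrite ?normc_ge0// lerDl.
have -> : (normc a + 1) * (e / 2 / (normc a + 1)) = e / 2.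
  by field; rewrite gt_eqF.
lra.
Qed.

Lemma normc_conj (z : C) : normc z^*%C = normc z.
Proof. by case: z => a b; rewrite /normc /= sqrrN. Qed.

Lemma sums_conj z l : sums z l -> sums (fun i => (z i)^*%C) l^*%C.
Proof.
move=> zl e e0; have [A AP] := zl e e0; exists A => B /AP.
by rewrite -normc_conj rmorphB rmorph_sum.
Qed.

Lemma sums_nonneg (z : I -> R) (K : R) : (forall i, 0 <= z i) ->
  (forall A : {fset I}, \sum_(i <- A) z i <= K) ->
  exists l, sums (fun i => (z i)%:C%C) l.
Proof.
move=> z0 zK.
pose X := [set (\sum_(i <- A) z i) | A in [set: {fset I}]].
have Xsup : has_sup X.
  split; first by exists 0; exists fset0; rewrite ?big_seq_fset0.
  by exists K => _ [A _ <-].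
exists ((sup X)%:C%C) => e e0.
have [_ [A0 _ <-] A0e] := sup_adherent e0 Xsup.
exists A0 => A A0A; rewrite -rmorph_sum -rmorphB normc_real.
have AX : \sum_(i <- A) z i <= sup X by apply: sup_upper_bound => //; exists A.
have A0A' : \sum_(i <- A0) z i <= \sum_(i <- A) z i.
  rewrite [leRHS](big_fsetID _ (mem A0)) /=.
  rewrite (_ : [fset x | x in A & x \in A0]%fset = A0) ?lerDl ?sumr_ge0//.
  apply/fsetP => i; rewrite !inE /=.
  by case: (boolP (i \in A0)) => [/(fsubsetP A0A) ->|]; rewrite ?andbF.
by rewrite ger0_norm; lra.
Qed.

(** Real and imaginary parts are split into positive and negative parts, each summed by its
    supremum. *)
Lemma sums_absolute (z : I -> C) (K : R) :
  (forall A : {fset I}, \sum_(i <- A) normc (z i) <= K) -> exists l, sums z l.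
Proof.
move=> zK.
have part (u : I -> R) : (forall i, `|u i| <= normc (z i)) ->
    exists l, sums (fun i => (u i)%:C%C) l.
  move=> uz.
  have [|A|l1 L1] := @sums_nonneg (fun i => (`|u i| + u i) / 2) K.
  - by move=> i; rewrite divr_ge0//; have := ler_norm (- u i); rewrite normrN; lra.
  - apply: le_trans (zK A); apply: ler_sum => i _; apply: le_trans (uz i).
    by have := ler_norm (u i); lra.
  have [|A|l2 L2] := @sums_nonneg (fun i => (`|u i| - u i) / 2) K.
  - by move=> i; rewrite divr_ge0//; have := ler_norm (u i); lra.
  - apply: le_trans (zK A); apply: ler_sum => i _; apply: le_trans (uz i).
    by have := ler_norm (- u i); rewrite normrN; lra.
  exists (-1 * l2 + l1); apply: sums_ext (sums_lin (-1) L2 L1) => i.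
  by rewrite mulN1r -rmorphN -rmorphD /=; congr (_%:C)%C; lra.
have [l1 L1] := part _ (fun i => Re_le_normc (z i)).
have [l2 L2] := part _ (fun i => Im_le_normc (z i)).
exists ('i%C * l2 + l1); apply: sums_ext (sums_lin 'i%C L2 L1) => i.
by case: (z i) => a b /=; simpc.
Qed.

Lemma normcM_le (z w : C) (t : R) : 0 < t ->
  normc (z * w) <= (t^-1 * normc z ^+ 2 + t * normc w ^+ 2) / 2.
Proof.
move=> t0; rewrite normcM; have := sqr_ge0 (normc z - t * normc w).
have -> : normc z * normc w = t^-1 / 2 * (2 * normc z * (t * normc w)).
  by field; rewrite gt_eqF.
have -> : (t^-1 * normc z ^+ 2 + t * normc w ^+ 2) / 2 =
    t^-1 / 2 * (normc z ^+ 2 + (t * normc w) ^+ 2).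
  by field; rewrite gt_eqF.
by rewrite ler_pM2l ?divr_gt0 ?invr_gt0//; lra.
Qed.

Lemma normc_sum_le (J : eqType) (s : seq J) (z : J -> C) :
  normc (\sum_(i <- s) z i) <= \sum_(i <- s) normc (z i).
Proof.
elim/big_ind2 : _ => // [|a b c d ab cd]; first by rewrite normc0.
by apply: le_trans (le_normcD _ _) _; exact: lerD.
Qed.

Lemma sum_mul_le x y (t : R) (A : {fset I}) : 0 < t ->
  \sum_(i <- A) normc (x i * (y i)^*%C) <=
  (t^-1 * normsq x + t * normsq y) / 2.
Proof.
move=> t0.
apply: (@le_trans _ _ (\sum_(i <- A)
  (t^-1 * normc (x i) ^+ 2 + t * normc (y i) ^+ 2) / 2)).
  by apply: ler_sum => i _; have := normcM_le (x i) (y i)^*%C t0; rewrite normc_conj.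
rewrite -mulr_suml big_split /= -!mulr_sumr ler_pM2r// lerD// ler_pM2l ?invr_gt0//;
  exact: sum_le_normsq.
Qed.

Lemma sums_inner x y : sums (fun i => x i * (y i)^*%C) (inner x y).
Proof.
have [l zl] := sums_absolute (fun A => sum_mul_le x y A ltr01).
by rewrite /inner (sums_lim zl).
Qed.

Lemma sums_inner_eq x y l : sums (fun i => x i * (y i)^*%C) l -> inner x y = l.
Proof. exact: sums_lim. Qed.

Lemma inner_lin a x x' y : inner (a *: x + x') y = a * inner x y + inner x' y.
Proof.
apply: sums_inner_eq.
apply: sums_ext (sums_lin a (sums_inner x y) (sums_inner x' y)) => i /=.
by rewrite mulrDl mulrA.
Qed.

Lemma inner0 y : inner 0 y = 0.
Proof.
have := inner_lin 1 0 0 y; rewrite scale1r addr0 mul1r => /eqP.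
by rewrite addrC -subr_eq subrr => /eqP.
Qed.

Lemma innerB x x' y : inner (x - x') y = inner x y - inner x' y.
Proof.
by rewrite addrC -scaleN1r inner_lin mulN1r addrC.
Qed.

Lemma inner_sum (s : seq I) (c : I -> C) (v : I -> H) y :
  inner (\sum_(i <- s) c i *: v i) y = \sum_(i <- s) c i * inner (v i) y.
Proof.
elim: s => [|i s IH]; first by rewrite !big_nil inner0.
by rewrite !big_cons inner_lin IH.
Qed.

Lemma innerC x y : inner x y = (inner y x)^*%C.
Proof.
apply: sums_inner_eq; apply: sums_ext (sums_conj (sums_inner y x)) => i.
by rewrite rmorphM /= conjcK mulrC.
Qed.

(** Cauchy-Schwarz in weighted AM-GM form; the weight [t] is fixed at each use. *)
Lemma inner_le x y (t : R) : 0 < t ->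
  normc (inner x y) <= (t^-1 * normsq x + t * normsq y) / 2.
Proof.
move=> t0; apply/ler_addgt0Pr => e e0.
have [A AP] := sums_inner x y e0.
have := AP A (fsubset_refl A); set s := \sum_(i <- A) _ => H.
have -> : inner x y = s + (inner x y - s) by ring.
apply: le_trans (le_normcD _ _) _; apply: lerD H.
by apply: le_trans (normc_sum_le _ _) _; exact: sum_mul_le.
Qed.

Lemma inner_self_ge x p : normc (x p) ^+ 2 <= complex.Re (inner x x).
Proof.
apply/ler_addgt0Pr => e e0.
have [A AP] := sums_inner x x e0.
have := AP (p |` A)%fset (fsubsetU1 _ _).
set s := \sum_(i <- _) _ => H.
have Hs : complex.Re s = \sum_(i <- (p |` A)%fset) normc (x i) ^+ 2.
  rewrite /s raddf_sum; apply: eq_bigr => i _; rewrite normc_sqr.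
  by case: (x i) => a b /=; ring.
have sp : normc (x p) ^+ 2 <= complex.Re s.
  by rewrite Hs (big_fsetD1 p) ?fset1U1//= lerDl sumr_ge0// => i _; exact: sqr_ge0.
have : `|complex.Re (inner x x - s)| <= e.
  by apply: le_trans H; exact: Re_le_normc.
by rewrite raddfB /= ler_norml => /andP[]; lra.
Qed.

Lemma basis_subproof (j : I) :
  (fun i => (i == j)%:R : C) \in @sq_summable R I.
Proof.
apply/asboolP; apply: (@le_lt_trans _ _ 1%E); last exact: ltry.
apply: sqsum_le => A; have [jA|jA] := boolP (j \in A).
  rewrite (big_fsetD1 j)//= eqxx normc1 expr1n big1_seq ?addr0// => i.
  by rewrite !inE => /andP[_ /andP[/negbTE ->]]; rewrite normc0 expr0n.
rewrite big1_seq// => i /andP[_ iA]; case: eqP => [ij|_].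
  by rewrite ij (negbTE jA) in iA.
by rewrite normc0 expr0n.
Qed.

Definition basis j : H := Ell2 (basis_subproof j).

Definition trunc (A : {fset I}) (z : I -> C) : H := \sum_(i <- A) z i *: basis i.

Lemma truncE A z i : trunc A z i = if i \in A then z i else 0.
Proof.
have -> : trunc A z i = \sum_(j <- A) z j * (i == j)%:R.
  by rewrite /trunc; elim/big_ind2 : _ => // a b c d <- <-.
have [iA|iA] := boolP (i \in A).
  rewrite (big_fsetD1 i)//= eqxx mulr1 big1_seq ?addr0// => j.
  by rewrite !inE eq_sym => /andP[_ /andP[/negbTE ->]]; rewrite mulr0.
rewrite big1_seq// => j /andP[_ jA]; case: eqP => [ij|_]; last by rewrite mulr0.
by rewrite ij jA in iA.
Qed.

Lemma normsq_trunc_le A z : normsq (trunc A z) <= \sum_(i <- A) normc (z i) ^+ 2.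
Proof.
apply: normsq_le => B; under eq_bigr do rewrite truncE.
rewrite (big_fsetID _ (mem A)) /= [X in _ + X]big1_seq ?addr0; last first.
  by move=> i; rewrite !inE /= => /andP[_ /negbTE ->]; rewrite normc0 expr0n.
rewrite [leRHS](big_fsetID _ (mem B)) /=.
rewrite (_ : [fset x | x in A & x \in B]%fset = [fset x | x in B & x \in A]%fset).
  rewrite [leLHS]big_seq [X in X + _]big_seq.
  rewrite (eq_bigr (fun i => normc (z i) ^+ 2)); last first.
    by move=> i; rewrite !inE /= => /andP[_ ->].
  by rewrite lerDl sumr_ge0// => i _; exact: sqr_ge0.
by apply/fsetP => i; rewrite !inE /= andbC.
Qed.

(** On a finite set [B], the squared norm of the remainder is the difference of the partial sums
    over the union of [A] and [B] and over [A], both within [e / 2] of the limit. *)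
Lemma trunc_cvg x (e : R) : 0 < e -> exists A0 : {fset I},
  forall A : {fset I}, (A0 `<=` A)%fset -> normsq (x - trunc A x) <= e.
Proof.
move=> e0.
have [|A|l L] := @sums_nonneg (fun i => normc (x i) ^+ 2) (normsq x).
- by move=> i; exact: sqr_ge0.
- exact: sum_le_normsq.
have [|A0 A0P] := L (e / 2); first by rewrite divr_gt0.
exists A0 => A A0A; apply: normsq_le => B.
have -> : \sum_(i <- B) normc ((x - trunc A x) i) ^+ 2 =
    \sum_(i <- (A `|` B)%fset) normc (x i) ^+ 2 - \sum_(i <- A) normc (x i) ^+ 2.
  have E i : (x - trunc A x) i = if i \in A then 0 else x i.
    transitivity (x i - trunc A x i); first by [].
    by rewrite truncE; case: ifP => _; rewrite ?subrr ?subr0.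
  under eq_bigr do rewrite E.
  rewrite (big_fsetID _ (mem A)) /= big1_seq ?add0r; last first.
    by move=> i; rewrite !inE /= => /andP[_ ->]; rewrite normc0 expr0n.
  rewrite [X in _ = X - _](big_fsetID _ (mem A)) /=.
  rewrite (_ : [fset x | x in (A `|` B) & x \in A]%fset = A); last first.
    by apply/fsetP => i; rewrite !inE /=; case: (i \in A); rewrite ?andbF.
  rewrite (_ : [fset x | x in (A `|` B) & x \notin A]%fset
             = [fset x | x in B & x \notin A]%fset); last first.
    by apply/fsetP => i; rewrite !inE /=; case: (i \in A); rewrite ?andbF.
  rewrite addrAC subrr add0r big_seq [RHS]big_seq; apply: eq_bigr => i.
  by rewrite !inE /= => /andP[_ /negbTE ->].
have := A0P _ A0A; have := A0P _ (fsubset_trans A0A (fsubsetUl A B)).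
rewrite -!rmorph_sum /=.
have D (a b : R) : normc (l - a%:C%C) <= e / 2 -> normc (l - b%:C%C) <= e / 2 -> a - b <= e.
  move=> la lb; apply: (le_trans (ler_norm _)); rewrite -normc_real rmorphB.
  have -> : a%:C%C - b%:C%C = (l - b%:C%C) - (l - a%:C%C) by ring.
  by apply: le_trans (le_normcD _ _) _; rewrite normcN; lra.
exact: D.
Qed.

(** * Existence of adjoints of bounded operators *)

Section Riesz.
Variables (T : H -> H) (K : R).
Hypotheses (Tlin : linear T) (K0 : 0 < K)
  (TK : forall x, normsq (T x) <= K * normsq x).

Lemma op0 : T 0 = 0.
Proof. by have := Tlin (-1) 0 0; rewrite scaler0 addr0 scaleN1r addNr. Qed.

Lemma op_sum (s : seq I) (c : I -> C) (v : I -> H) :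
  T (\sum_(i <- s) c i *: v i) = \sum_(i <- s) c i *: T (v i).
Proof.
elim: s => [|i s IH]; first by rewrite !big_nil op0.
by rewrite !big_cons Tlin IH.
Qed.

Lemma opB x y : T (x - y) = T x - T y.
Proof. by rewrite addrC -scaleN1r Tlin scaleN1r addrC. Qed.

Lemma riesz y : exists z : H, forall x, inner (T x) y = inner x z.
Proof.
pose zf i : C := (inner (T (basis i)) y)^*%C.
have Etr (A : {fset I}) (c : I -> C) :
    inner (T (trunc A c)) y = \sum_(i <- A) c i * (zf i)^*%C.
  rewrite /trunc op_sum inner_sum; apply: eq_bigr => i _.
  by rewrite /zf conjcK.
have zl2 : zf \in @sq_summable R I.
  apply/asboolP; apply: (@le_lt_trans _ _ (K * normsq y)%:E); last exact: ltry.
  apply: sqsum_le => A; set s := \sum_(i <- A) _.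
  have Es : inner (T (trunc A zf)) y = s%:C%C.
    rewrite Etr rmorph_sum; apply: eq_bigr => i _; rewrite normc_sqr.
    by case: (zf i) => a b; simpc; congr (_ +i* _)%C; ring.
  have s0 : 0 <= s by apply: sumr_ge0 => i _; exact: sqr_ge0.
  (* Testing on the truncation of [zf] itself gives [s <= (s + K * normsq y) / 2], which bounds
     [s]. *)
  have := inner_le (T (trunc A zf)) y K0.
  rewrite Es normc_real ger0_norm//.
  have : K^-1 * normsq (T (trunc A zf)) <= s.
    rewrite mulrC ler_pdivrMr//; apply: le_trans (TK _) _.
    by rewrite mulrC ler_pM2r// normsq_trunc_le.
  lra.
exists (Ell2 zl2) => x; apply/esym/sums_inner_eq => e e0 /=.
pose t := e / (normsq y + 1).
have y1 : 0 < normsq y + 1 by rewrite ltr_wpDl// normsq_ge0.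
have t0 : 0 < t by rewrite divr_gt0.
have [|A0 A0P] := @trunc_cvg x (t * e / K); first by rewrite divr_gt0// mulr_gt0.
exists A0 => A /A0P xA; rewrite -Etr -innerB -opB.
apply: le_trans (inner_le _ _ t0) _.
have : t^-1 * normsq (T (x - trunc A x)) <= e.
  rewrite mulrC ler_pdivrMr//; apply: le_trans (TK _) _.
  by rewrite -ler_pdivlMl// mulrC [e * t]mulrC.
have : t * normsq y <= e.
  by rewrite /t mulrAC ler_pdivrMr// ler_pM2l// lerDl.
lra.
Qed.

End Riesz.

(** [riesz] provides a witness, so [xget] does not return its default value 0. *)
Lemma adjoint_opP (T : H -> H) : bounded_op T ->
  forall x y, inner (T x) y = inner x (adjoint_op T y).
Proof.
move=> [Tlin [k Tk]].
pose K := `|k| + 1; have K0 : 0 < K by rewrite ltr_wpDl.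
have TK x : normsq (T x) <= K * normsq x.
  apply: le_trans (Tk x) _; rewrite ler_wpM2r ?normsq_ge0//.
  by apply: le_trans (ler_norm k) _; rewrite lerDl.
have [S SP] := choice (riesz Tlin K0 TK).
have := @xgetPex _ (fun=> 0) [set S | forall x y, inner (T x) y = inner x (S y)].
by apply; exists S => x y; exact: SP.
Qed.

Lemma adjoint_op_sqr_ge (T : H -> H) x p : bounded_op T ->
  normc (T x p) ^+ 2 <= complex.Re (inner (adjoint_op T (T x)) x).
Proof.
move=> /adjoint_opP TP; rewrite innerC -TP.
by have := inner_self_ge (T x) p; case: (inner _ _).
Qed.

End InnerProduct.

(** * The group von Neumann algebra *)

Section SquareSummableSchur.
Variables (R : realType) (G : groupType).

Lemma sum_by_fibres (I : finType) (p : I -> G) (F : I -> R) :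
  \sum_i F i = \sum_(r <- undup (map p (enum I))) \sum_(i | p i == r) F i.
Proof.
rewrite (exchange_big_dep xpredT)//=; apply: eq_bigr => i _.
rewrite big_mkcond (bigD1_seq (p i)) ?undup_uniq//=; last first.
  by rewrite mem_undup map_f// mem_enum.
by rewrite eqxx big1 ?addr0// => r; rewrite eq_sym => /negbTE ->.
Qed.

(** Rows with the same label [r] see the same vector [u], so the contraction bounds their joint
    contribution by the squared norm of [u]. Summing over the distinct labels first leaves, for each
    [j], a sum of squares of [g] over distinct points. *)
Lemma schur_square_summable (g : G -> R) (e : R) : 0 < e ->
  (forall s : seq G, uniq s -> \sum_(x <- s) g x ^+ 2 <= e ^+ 2) -> schur g e.
Proof.
move=> e0 ge; apply: schur_of_sqn => // I p q A cA v.
pose s := undup (map p (enum I)).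
rewrite /sqn (sum_by_fibres p).
apply: (@le_trans _ _ (\sum_(r <- s) \sum_j g (r * (q j)^-1)%g ^+ 2 * v j ^+ 2)).
  apply: ler_sum => r _; pose u j := g (r * (q j)^-1)%g * v j.
  under [leRHS]eq_bigr do rewrite -exprMn.
  apply: le_trans (contraction_sqn u cA).
  rewrite /sqn [leRHS](bigID (fun i => p i == r)) /=; apply: ler_wpDr.
    by apply: sumr_ge0 => i _; exact: sqr_ge0.
  apply: ler_sum => i /eqP pr; rewrite pr le_eqVlt; apply/orP; left; apply/eqP.
  by congr (_ ^+ 2); apply: eq_bigr => j _; rewrite mulrA.
rewrite exchange_big mulr_sumr; apply: ler_sum => j _ /=.
rewrite -mulr_suml ler_wpM2r ?sqr_ge0//.
have := ge (map (fun r => (r * (q j)^-1)%g) s).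
by rewrite big_map; apply; rewrite map_inj_uniq ?undup_uniq//; exact: mulIg.
Qed.

Lemma schur_truncate (g : G -> R) (K c e : R) (E : seq G) : 0 < e ->
  (forall s : seq G, uniq s -> \sum_(x <- s) g x ^+ 2 <= K) -> schur g c ->
  exists h : G -> R, [/\ finite_set [set x | h x != 0], schur h (c + e)
    & forall x, x \in E -> h x = g x].
Proof.
move=> e0 gK gc.
pose X := [set r | exists s : seq G, uniq s /\ r = \sum_(x <- s) g x ^+ 2].
have Xsup : has_sup X.
  split; first by exists 0; exists [::]; rewrite big_nil.
  by exists K => _ [s [us ->]]; exact: gK.
(* The finite set [s] carries all but [e ^+ 2] of the total sum of squares, so what is cut off has
   Schur norm at most [e]. *)
have [_ [s [us ->]] sX] := sup_adherent (exprn_gt0 2 e0) Xsup.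
pose t := undup (s ++ E).
pose h x := if x \in t then g x else 0.
exists h; split.
- apply: (@sub_finite_set _ _ [set` t]); last exact: finite_seq.
  by move=> x /=; rewrite /h; case: ifP => //; rewrite eqxx.
- have hg : schur (fun x => (x \notin t)%:R * - g x) e.
    apply: schur_square_summable => // u uu.
    have H : \sum_(x <- s) g x ^+ 2 + \sum_(x <- u | x \notin t) g x ^+ 2 <= sup X.
      apply: (sup_upper_bound Xsup).
      exists (s ++ [seq x <- u | x \notin t]); rewrite big_cat big_filter.
      split=> //; rewrite cat_uniq us filter_uniq// andbT /=.
      apply/hasPn => x; rewrite mem_filter mem_undup mem_cat negb_or.
      by case/andP => /andP[].
    rewrite [leLHS](_ : _ = \sum_(x <- u | x \notin t) g x ^+ 2); first lra.
    rewrite [RHS]big_mkcond; apply: eq_bigr => x _; case: (x \in t) => /=.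
      by rewrite mul0r expr0n.
    by rewrite mul1r sqrrN.
  apply: schur_eq (schurD gc hg) => x; rewrite /h; case: (x \in t) => /=.
    by rewrite mul0r addr0.
  by rewrite mul1r subrr.
- by move=> x xE; rewrite /h mem_undup mem_cat xE orbT.
Qed.

End SquareSummableSchur.

(** * Finite-dimensional subspaces of the Hilbert space *)

Section FiniteDimensional.
Variables (R : realType) (I : choiceType).
Local Notation C := R[i].
Local Notation H := (ell2 R I).

Definition recon (L : seq (I * H)) (w : H) : H := \sum_(j <- L) w j.1 *: j.2.

Lemma ell2P (x y : H) : (forall i, x i = y i) -> x = y.
Proof. by move=> xy; apply: val_inj; apply/funext. Qed.

Lemma ell2_sum_seqE (J : Type) (s : seq J) (y : J -> H) i :
  (\sum_(j <- s) y j) i = \sum_(j <- s) y j i.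
Proof. by elim/big_ind2 : _ => // a b c d <- <-. Qed.

Lemma reconE L w i : recon L w i = \sum_(j <- L) w j.1 * j.2 i.
Proof. by rewrite /recon ell2_sum_seqE. Qed.

(* A finite-dimensional space of functions has a basis dual to evaluation at
   finitely many points. *)
Lemma finite_dim_recon d (y : 'I_d -> H) :
  exists L : seq (I * H), forall c : 'I_d -> C,
    let w := \sum_i c i *: y i in w = recon L w.
Proof.
elim: d y => [|d IH] y.
  by exists [::] => c /=; rewrite /recon big_ord0 big_nil.
have [L LP] := IH (fun i => y (widen_ord (leqnSn d) i)).
set v := y ord_max; pose v' := v - recon L v.
have key (c : 'I_d.+1 -> C) i : let w := \sum_i c i *: y i in
    w i = recon L w i + c ord_max * v' i.
  move=> w; have := LP (fun i => c (widen_ord (leqnSn d) i)).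
  set w0 := \sum_(i < d) _ => /(congr1 (fun u : H => u i)) w0E.
  have wE h : w h = w0 h + c ord_max * v h by rewrite /w big_ord_recr.
  have -> : recon L w i = recon L w0 i + c ord_max * recon L v i.
    rewrite !reconE mulr_sumr -big_split; apply: eq_bigr => j _ /=.
    by rewrite wE; ring.
  transitivity (recon L w0 i + c ord_max * recon L v i
                + c ord_max * (v i - recon L v i)); last by [].
  by rewrite wE w0E; ring.
have [v'0|] := pselect (forall i, v' i = 0).
  exists L => c /=; apply: ell2P => i.
  by rewrite [LHS]key v'0 mulr0 addr0.
move=> /existsNP [i0 /eqP v'i0].
(* The residual [v'] of the new generator is normalised to be 1 at [i0]; the old dual vectors are
   corrected by multiples of it so as to vanish at [i0]. *)
exists ((i0, (v' i0)^-1 *: v') ::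
  [seq (j.1, j.2 - (j.2 i0 / v' i0) *: v' : H) | j : I * H <- L]) => c w.
apply: ell2P => i; rewrite reconE big_cons big_map /=.
have E : c ord_max = (w i0 - recon L w i0) / v' i0.
  by rewrite [w i0]key -/w addrC addrA addNr add0r mulfK.
transitivity (w i0 * ((v' i0)^-1 * v' i) +
    \sum_(j <- L) w j.1 * (j.2 i - (j.2 i0 / v' i0) * v' i)); last by [].
have -> : \sum_(j <- L) w j.1 * (j.2 i - (j.2 i0 / v' i0) * v' i) =
   recon L w i - recon L w i0 / v' i0 * v' i.
  rewrite !reconE !mulr_suml -sumrB; apply: eq_bigr => j _; ring.
by rewrite [LHS]key -/w E; ring.
Qed.

Lemma sum_le_normsq_uniq (x : H) (s : seq I) : uniq s ->
  \sum_(i <- s) normc (x i) ^+ 2 <= normsq x.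
Proof.
move=> us; have := sum_le_normsq x [fset i in s]%fset; apply: le_trans.
rewrite le_eqVlt; apply/orP; left; apply/eqP; apply: perm_big.
by apply: uniq_perm => // i; rewrite ?fset_uniq// inE.
Qed.

(** [M] is the sum of the absolute values of the dual vectors: a function bounded by [b] is
    reconstructed from values of size at most [b]. *)
Lemma finite_dim_majorant d (y : 'I_d -> H) : exists (M : I -> R) (K : R),
  (forall s, uniq s -> \sum_(i <- s) M i ^+ 2 <= K) /\
  forall (c : 'I_d -> C) b, (forall i, normc ((\sum_j c j *: y j) i) <= b) ->
    forall i, normc ((\sum_j c j *: y j) i) <= b * M i.
Proof.
have [L LP] := finite_dim_recon y.
pose M i := \sum_(j <- L) normc (j.2 i).
suff [K KP] : exists K, forall s, uniq s -> \sum_(i <- s) M i ^+ 2 <= K.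
  exists M, K; split=> // c b; move: (LP c) => /=; set w := \sum_j _ => wE wb i.
  rewrite {1}wE reconE; apply: le_trans (normc_sum_le _ _) _.
  rewrite /M mulr_sumr; apply: ler_sum => j _; rewrite normcM.
  by rewrite ler_wpM2r ?normc_ge0.
rewrite /M; elim: L {LP M} => [|[j x] L [K KP]].
  by exists 0 => s us; rewrite big1// => i _; rewrite big_nil expr0n.
exists (2 * normsq x + 2 * K) => s us.
apply: (@le_trans _ _ (2 * (\sum_(i <- s) normc (x i) ^+ 2) +
    2 * (\sum_(i <- s) (\sum_(j <- L) normc (j.2 i)) ^+ 2))).
  rewrite !mulr_sumr -big_split; apply: ler_sum => i _; rewrite big_cons /=.
  set a := normc _; set b := \sum_(_ <- _) _.
  by have := sqr_ge0 (a - b); lra.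
have := KP s us; have := sum_le_normsq_uniq x us; lra.
Qed.

End FiniteDimensional.

(** * Coefficients of maps on the group von Neumann algebra *)

Section VonNeumannCase.
Variables (R : realType) (G : groupType).
Local Notation C := R[i].
Local Notation H := (ell2 R G).
Local Notation M := (group_vN R G).

Lemma rtrans_subproof (g : G) (x : H) :
  (fun h => x (h * g)%g) \in @sq_summable R G.
Proof.
apply/asboolP; apply: (@le_lt_trans _ _ (normsq x)%:E); last exact: ltry.
apply: sqsum_le => A.
rewrite -(big_map (fun h => (h * g)%g) xpredT (fun h => normc (x h) ^+ 2)).
by apply: sum_le_normsq_uniq; rewrite map_inj_uniq ?fset_uniq//; exact: mulIg.
Qed.

Definition rtrans g x : H := Ell2 (rtrans_subproof g x).

Lemma bounded_rtrans g : bounded_op (rtrans g).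
Proof.
split; first by move=> a u v; exact: ell2P.
exists 1 => x; rewrite mul1r; apply: normsq_le => A.
rewrite -(big_map (fun h => (h * g)%g) xpredT (fun h => normc (x h) ^+ 2)).
by apply: sum_le_normsq_uniq; rewrite map_inj_uniq ?fset_uniq//; exact: mulIg.
Qed.

Lemma rtrans_ltrans r g : rtrans r \o ltrans g = ltrans g \o rtrans r.
Proof. by apply/funext => x; apply: ell2P => h /=; rewrite mulgA. Qed.

Lemma dirac_rtrans q : dirac R q = rtrans q^-1%g (delta1 R G).
Proof.
apply: ell2P => h; rewrite diracE /=.
by rewrite -(inj_eq (@mulIg _ q)) -mulgA mulVg mulg1 mul1g.
Qed.

Lemma group_vN_ltrans (a : C) g : M (a *: ltrans g).
Proof.
split; first split.
- move=> b u v; apply: ell2P => h; exact: (linearP (GRing.scale a : C^o -> C^o)).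
- exists (normc a ^+ 2) => x; apply: le_trans (normsqZ_le _ _) _.
  by rewrite normsq_ltrans.
- move=> y [ylin _] yg; apply/funext => x /=.
  transitivity (a *: (ltrans g \o y) x); first by [].
  rewrite -yg; have := ylin a (ltrans g x) 0.
  by rewrite (op0 ylin) !addr0 => <-.
Qed.

Section Coefficient.
Variable phi : (H -> H) -> H -> H.

Definition coef (g : G) : C := phi (ltrans g) (delta1 R G) g.

Hypothesis phil : linear_on M phi.

Lemma M_ltrans g : M (ltrans g).
Proof. by have := group_vN_ltrans 1 g; rewrite scale1r. Qed.

Lemma linear_onZ (a : C) x : M x -> phi (a *: x) = a *: phi x.
Proof.
move=> Mx; have := phil.2 (a - 1) x x Mx Mx.
rewrite -{2}(scale1r x) -scalerDl subrK => ->.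
by rewrite -{2}(scale1r (phi x)) -scalerDl subrK.
Qed.

(** Elements of [M] commute with right translations, because these commute with left ones; so the
    matrix of [x] depends on [p * q^-1] alone. *)
Lemma group_vN_dirac (x : H -> H) (b : C) p q : M x ->
  x (b *: dirac R q) p = b * x (delta1 R G) (p * q^-1)%g.
Proof.
move=> [[xlin _] xc].
have := xlin b (dirac R q) 0; rewrite !addr0.
rewrite (op0 xlin) addr0 => ->.
rewrite dirac_rtrans; have := xc _ (bounded_rtrans q^-1%g) (rtrans_ltrans _).
by move=> /(congr1 (fun f => f (delta1 R G))) /= ->.
Qed.

Lemma coef_schur (c : R) : 0 < c -> (cb_norm id M phi <= c%:E)%E ->
  schur (fun g => complex.Re (coef g)) c.
Proof.
move=> c0 /(schur_of_cb_norm c0) S.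
apply: (S (fun a g => a%:C%C *: ltrans g)) => //.
  by move=> a g; exact: group_vN_ltrans.
move=> a b p q; rewrite linear_onZ; last exact: M_ltrans.
transitivity (a%:C%C * phi (ltrans (p * q^-1)%g) (b%:C%C *: dirac R q) p).
  by [].
rewrite group_vN_dirac; last exact/phil.1/M_ltrans.
by rewrite mulrA rmorphM.
Qed.

Lemma normsq_coef_le (c : R) g : (cb_norm id M phi <= c%:E)%E ->
  0 <= c /\ normsq (phi (ltrans g) (delta1 R G)) <= c ^+ 2.
Proof.
move=> cb; pose X : 'M[H -> H]_1 := const_mx (ltrans g).
have X1 : (mx_opnorm (map_mx id X) <= 1)%E.
  apply: ge_ereal_sup => _ [y y1 <-]; rewrite lee_fin -[leRHS]sqrtr1.
  rewrite ler_sqrt//; apply: le_trans y1; rewrite /tuple_normsq !big_ord1.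
  by rewrite !mxE normsq_ltrans.
have X2 : (mx_opnorm (map_mx (id \o phi) X) <= c%:E)%E.
  apply: le_trans cb; apply: ereal_sup_ubound.
  exists (existT (fun n => 'M[H -> H]_n) 1%N X) => //; split=> // i j.
  by rewrite mxE; exact: M_ltrans.
have y1 : tuple_normsq (fun _ : 'I_1 => dirac R (1%g : G)) <= 1.
  by rewrite /tuple_normsq big_ord1 normsq_dirac.
have := mx_opnorm_normsq_le X2 y1; rewrite !big_ord1 !mxE /=.
suff -> : dirac R 1%g = delta1 R G by [].
by apply: ell2P => h; rewrite diracE.
Qed.

(** By finite rank, all the vectors [phi (ltrans g) delta1] lie in one finite-dimensional space, and
    their coordinates are bounded by [c]. One square-summable function times [c] therefore dominates
    them all, in particular the coordinate at [g]. *)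
Lemma coef_square_summable (c : R) : (cb_norm id M phi <= c%:E)%E ->
  finite_rank M phi -> exists K, forall s, uniq s ->
    \sum_(g <- s) complex.Re (coef g) ^+ 2 <= K.
Proof.
move=> cb [d [y yP]].
have [m [K [mK mP]]] := finite_dim_majorant (fun i => y i (delta1 R G)).
exists (c ^+ 2 * K) => s us.
apply: le_trans (_ : c ^+ 2 * \sum_(g <- s) m g ^+ 2 <= _); last first.
  by rewrite ler_wpM2l ?sqr_ge0// mK.
rewrite mulr_sumr; apply: ler_sum => g _.
have [c0 gc] := normsq_coef_le g cb.
have [a aE] := yP _ (M_ltrans g).
have vE : phi (ltrans g) (delta1 R G) = \sum_i a i *: y i (delta1 R G).
  by rewrite aE; elim/big_rec2 : _ => // i u u' _ <-.
have bd i : normc ((\sum_j a j *: y j (delta1 R G)) i) <= c.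
  rewrite -vE -(@ler_pXn2r _ 2) ?nnegrE ?normc_ge0//.
  by apply: le_trans (normc_le_normsq _ _) gc.
have := mP a c bd g; rewrite -vE => H.
apply: (@le_trans _ _ (normc (coef g) ^+ 2)).
  by rewrite normc_sqr lerDl sqr_ge0.
by rewrite -exprMn ler_pXn2r ?nnegrE ?normc_ge0// (le_trans _ H)// normc_ge0.
Qed.

(** The squared trace norm of [T] is its squared length on [delta1], which dominates the square of
    the coordinate at [g], namely of [1 - coef g]. *)
Lemma coef_near (e : R) g : 
  trace_norm2 (group_trace R G) (ltrans g - phi (ltrans g)) <= e ->
  normc (1 - coef g) <= e.
Proof.
set T := ltrans g - _ => Te.
have bT : bounded_op T.
  have [[l1 [k1 K1]] _] := M_ltrans g.
  have [[l2 [k2 K2]] _] := phil.1 _ (M_ltrans g).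
  split.
    move=> a u v; rewrite -[T _]/(ltrans g _ - phi (ltrans g) _) l1 l2.
    rewrite -[T u]/(ltrans g u - phi (ltrans g) u).
    rewrite -[T v]/(ltrans g v - phi (ltrans g) v).
    by rewrite scalerBr opprD addrACA.
  exists (2 * k1 + 2 * k2) => x.
  have : normsq (T x) <= 2 * normsq (ltrans g x) + 2 * normsq (phi (ltrans g) x).
    apply: normsq_le => A.
    apply: (@le_trans _ _ (\sum_(i <- A) (2 * normc (ltrans g x i) ^+ 2
        + 2 * normc (phi (ltrans g) x i) ^+ 2))).
      apply: ler_sum => i _; rewrite -[T x i]/(ltrans g x i - phi (ltrans g) x i).
      rewrite !normc_sqr; case: (ltrans g x i) => a b.
      case: (phi (ltrans g) x i) => a' b' /=.
      by have := sqr_ge0 (a + a'); have := sqr_ge0 (b + b'); lra.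
    rewrite big_split /= -!mulr_sumr.
    apply: lerD; rewrite ler_pM2l//.
      exact: (sum_le_normsq (ltrans g x)).
    exact: (sum_le_normsq (phi (ltrans g) x)).
  by have := K1 x; have := K2 x; lra.
have e0 : 0 <= e by apply: le_trans Te; exact: sqrtr_ge0.
have := adjoint_op_sqr_ge (delta1 R G) g bT.
rewrite -[T _ g]/((ltrans g (delta1 R G) g) - coef g).
have -> : ltrans g (delta1 R G) g = 1.
  by have := diracE R g g; rewrite eqxx.
move=> H; rewrite -(@ler_pXn2r _ 2) ?nnegrE ?normc_ge0//; apply: le_trans H _.
(* [Num.sqrt] is 0 on negative numbers, so the bound on the square root is used only for [0 <= r]; a
   negative [r] lies below any square. *)
set r := complex.Re _; have [r0|r0] := leP 0 r; last first.
  by apply: ltW; apply: lt_le_trans r0 _; exact: sqr_ge0.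
rewrite -(sqr_sqrtr r0) ler_pXn2r ?nnegrE ?sqrtr_ge0//.
Qed.

End Coefficient.

Lemma schur_approximable_of_cmap :
  complete_metric_approximation_property M (group_trace R G) ->
  schur_approximable R G.
Proof.
move=> cmap E e e0.
(* Half of [e] is spent on the norm bound from the net and half on the truncation to finite
   support. *)
pose d := e / 2; have d0 : 0 < d by rewrite divr_gt0.
have : (vN_Lambda_cb M (group_trace R G) < (1 + d)%:E)%E.
  by rewrite cmap lte_fin ltrDl.
move=> /ereal_inf_lt[_ [c [c1 [N [le [phi [dle phiP fc f1]]]]] <-]].
rewrite lte_fin => cd.
have [n0 n0P] := net_limsup_le fc cd.
have ev x : exists n, forall p, le n p ->
    trace_norm2 (group_trace R G) (ltrans x - phi p (ltrans x)) <= d.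
  have := f1 _ (M_ltrans x) => /(_ _ (nbhsx_ballx (0 : R) d d0)) [n _ nP].
  exists n => p /nP; rewrite -ball_normE /= sub0r normrN => H.
  by apply: le_trans (ler_norm _) (ltW H).
have [p [n0p pE]] := directed_all dle E n0 ev.
have [plin _ pfr] := phiP p; have cb := n0P _ n0p.
have [K KP] := coef_square_summable cb pfr.
have sc : schur (fun g => complex.Re (coef (phi p) g)) (1 + d).
  by apply: coef_schur cb => //; rewrite addr_gt0.
have [h [hfin hs hE]] := schur_truncate E d0 KP sc.
exists h; split=> //; first by apply: schur_le hs; rewrite /d; lra.
move=> x xE; rewrite hE//; apply: (@le_trans _ _ d); last by rewrite /d; lra.
by apply: Re_dist_le; apply: coef_near => //; exact: pE.
Qed.

End VonNeumannCase.

Theorem corollary2p12 (R : realType) (Lambda Gamma : groupType)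
    (hLambda : exists a : Lambda, a <> 1%g)
    (hGamma : ~ amenable R Gamma) :
  (1 < group_Lambda_cb R (wreath Lambda Gamma))%E /\
  ~ complete_metric_approximation_property
      (group_vN R (wreath Lambda Gamma)) (group_trace R (wreath Lambda Gamma)).
Proof.
have [a /eqP a1] := hLambda.
have main := @amenable_of_schur_approximable R Lambda Gamma a a1.
split; last by move=> /schur_approximable_of_cmap /main.
by apply/not_notP => /schur_approximable_of_group_Lambda_cb /main.
Qed.
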